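(* Let $a,b$ be positive integers with $b\ge2$, let $N\in\mathbb N$, and let $\mu=(\mu_1,\dots,\mu_N)$ be integers with $\mu_1\ge\dots\ge\mu_N\ge0$ and $\mu_j<N+1-j$ for all $j$ (i.e. $\mu\subset\delta_N$). Then \[\zeta(a,b;\delta_N/\mu)=(-1)^{l_N(\mu)}\det F_N(\mu)\qquad\text{and}\qquad \zeta(a,b;\delta_N/\mu)=(-1)^{l_N(\mu')}\det F_N(\mu').\]
   Context: $\zeta(k_1,\dots,k_r)=\sum_{0<m_1<\dots<m_r}\prod m_i^{-k_i}$. Skew diagrams: for partitions $\lambda=(\lambda_1,\dots,\lambda_h)$ and $\mu$ (zero parts allowed, $\mu_j<\lambda_j$), $D(\lambda/\mu)=\{(i,j):1\le i\le h,\mu_i<j\le\lambda_i\}$; corners are cells $(i,j)$ with $(i,j+1),(i+1,j)\notin D$. For a filling $\mathbf k=(k_{i,j})$ by positive integers with entries $\ge2$ at corners, $\zeta(\mathbf k)=\sum\prod m_{i,j}^{-k_{i,j}}$ over fillings $(m_{i,j})$ by positive integers, strictly increasing down columns and weakly increasing along rows. The diagram is checkerboardable if there is a (unique) filling $\mathbf k_{a,b}$ with $k_{i,j}$ depending only on the parity of $i-j$, equal to $a$ on one parity class and $b$ on the other, and equal to $b$ at all corners; $\zeta(a,b;\lambda/\mu):=\zeta(\mathbf k_{a,b})$. $\delta_n=(n,n-1,\dots,1)$, $\delta_0=\delta_{-1}=\emptyset$. $B(n)=\zeta(a,b;\delta_{n+1}/\delta_{n-1})$ for $n\ge0$ and $B(n)=0$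 for $n<0$. For $\mu$ as in the claim: $J_0(\mu)=\{j\in\{1,\dots,N\}: N+j\not\equiv\mu_j \pmod 2\}$, $J_1(\mu)=\{j: N+j\equiv\mu_j\pmod2\}$; $m_j(\mu)=\frac{N+j-1-\mu_j}{2}$ if $j\in J_0(\mu)$ and $m_j(\mu)=\frac{N+j-2-\mu_j}{2}$ if $j\in J_1(\mu)$; $l_N(\mu)=\sum_{j\in J_0(\mu)}(m_j(\mu)+j+1)$. $B_N(\mu)$ is the $N\times N$ matrix with $(i,j)$ entry $(-1)^{m_j(\mu)-i+1}B(m_j(\mu)-i+1)$, and $F_N(\mu)$ is the $|J_1(\mu)|\times|J_1(\mu)|$ submatrix of $B_N(\mu)$ obtained by deleting, for every $j\in J_0(\mu)$, the $j$-th column and the $(m_j(\mu)+1)$-th row. $\mu'$ denotes the conjugate partition, $\mu'_k=\#\{j:\mu_j\ge k\}$ for $k=1,\dots,N$ (it also satisfies the hypotheses). *)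

(* Defs.v *)
From HB Require Import structures.
From mathcomp Require Import all_boot all_order all_algebra.
From mathcomp Require Import all_classical all_reals all_analysis.
From mathcomp Require Import zify.

Set Implicit Arguments.
Unset Strict Implicit.
Unset Printing Implicit Defensive.

Import Order.TTheory GRing.Theory Num.Theory.

Local Open Scope nat_scope.

(* A partition is a sequence of parts, padded with zeros; parts are numbered
   from 1, so [part la i] is only meaningful for 0 < i. *)
Definition part (la : seq nat) (i : nat) : nat := nth 0 la i.-1.

Definition staircase (n : nat) : seq nat := rev (iota 1 n).

Definition conj_part (N : nat) (mu : seq nat) : seq nat :=
  [seq count (fun x => k <= x) mu | k <- iota 1 N].

Definition cell : Type := (nat * nat)%type.

Definition skew (la mu : seq nat) : seq cell :=
  [seq (i, j) | i <- iota 1 (size la),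
                j <- iota (part mu i).+1 (part la i - part mu i)].

Lemma mem_skew (la mu : seq nat) (i j : nat) :
  ((i, j) \in skew la mu) = (1 <= i <= size la) && (part mu i < j <= part la i).
Proof.
apply/allpairsPdep/idP => [[i' [j' [+ + [-> ->]]]]|/andP[hi hj]].
  by rewrite !mem_iota; lia.
by exists i, j; rewrite !mem_iota; split=> //; lia.
Qed.

Definition corner (D : seq cell) (x : cell) : bool :=
  [&& x \in D, (x.1, x.2.+1) \notin D & (x.1.+1, x.2) \notin D].

Definition filling (D : seq cell) : Type := {ffun seq_sub D -> nat}.

Definition semistandard (D : seq cell) (m : filling D) : Prop :=
  [/\ forall c : seq_sub D, 0 < m c,
      forall c d : seq_sub D,
        (val c).2 = (val d).2 -> (val c).1 < (val d).1 -> m c < m d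
    & forall c d : seq_sub D,
        (val c).1 = (val d).1 -> (val c).2 <= (val d).2 -> m c <= m d].

(* The terms are nonnegative, so the series is a sum over a set in [0, +oo];
   [fine] reads off its real value, and is only junk if the series diverges. *)
Definition schur_zeta (R : realType) (D : seq cell) (k : filling D) : R :=
  fine (\esum_(m in [set m : filling D | semistandard m])
          (\prod_(c : seq_sub D) (m c)%:R ^- k c)%:E)%R.

(* The parity of i - j. *)
Definition parity (x : cell) : bool := odd (x.1 + x.2).

Definition is_checkerboard (a b : nat) (D : seq cell) (k : filling D) : Prop :=
  exists e : bool,
    (forall c : seq_sub D, k c = if parity (val c) == e then b else a) /\
    (forall c : seq_sub D, corner D (val c) -> k c = b).

(* The filling k_{a,b}; see [is_checkerboard_uniq] and
   [is_checkerboard_staircase]. *)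
Definition checkerboard (a b : nat) (D : seq cell) : filling D :=
  [ffun c => if has (fun x => corner D x && (parity x == parity (val c))) D
             then b else a].

Definition zeta_ab (R : realType) (a b : nat) (la mu : seq nat) : R :=
  schur_zeta R (checkerboard a b (skew la mu)).

Lemma exists_corner (D : seq cell) (x : cell) :
  x \in D -> exists2 y, y \in D & corner D y.
Proof.
pose s (y : cell) := y.1 + y.2.
have bnd y : y \in D -> s y <= \sum_(z <- D) s z.
  by move=> yD; rewrite (big_rem y yD) /= leq_addr.
move: {2}(_ - s x) (leqnn (\sum_(z <- D) s z - s x)) => n.
elim: n x => [|n IH] x hn xD.
  exists x => //; apply/and3P; split=> //; apply/negP => /bnd; have := bnd _ xD;
  by rewrite /s /= in hn *; lia.
have [h1|h1] := boolP ((x.1, x.2.+1) \in D).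
  by apply: (IH _ _ h1); have := bnd _ h1; rewrite /s /= in hn *; lia.
have [h2|h2] := boolP ((x.1.+1, x.2) \in D).
  by apply: (IH _ _ h2); have := bnd _ h2; rewrite /s /= in hn *; lia.
by exists x => //; apply/and3P.
Qed.

Lemma is_checkerboard_uniq (a b : nat) (D : seq cell) (k : filling D) :
  is_checkerboard a b k -> k = checkerboard a b D.
Proof.
case=> e [hk hc]; apply/ffunP => c; rewrite ffunE hk.
have [->|ab] := eqVneq a b; first by rewrite !if_same.
have cornerE x : x \in D -> corner D x -> parity x = e.
  move=> xD cx; have := hc (SeqSub xD) cx; rewrite hk /=.
  by case: eqP => // _ E; rewrite E eqxx in ab.
case: hasP => [[x xD /andP[cx /eqP <-]]|no].
  by rewrite (cornerE x) // eqxx.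
case: eqP => // ce; case: no.
have [y yD cy] := exists_corner (valP c); exists y => //.
by rewrite cy (cornerE y) // ce eqxx.
Qed.

Lemma part_staircase (N i : nat) :
  1 <= i <= N -> part (staircase N) i = N.+1 - i.
Proof.
by move=> hi; rewrite /part /staircase nth_rev size_iota ?nth_iota; lia.
Qed.

Lemma is_checkerboard_staircase (a b N : nat) (mu : seq nat) :
  (forall j, 1 <= j <= N -> part mu j < N.+1 - j) ->
  is_checkerboard a b (checkerboard a b (skew (staircase N) mu)).
Proof.
move=> hmu; set D := skew _ _.
have sD : size (staircase N) = N by rewrite size_rev size_iota.
have cornerE x : corner D x -> parity x = odd N.+1.
  case: x => i j /and3P[]; rewrite /= !mem_skew sD /parity /= => /andP[hi].
  rewrite hi part_staircase // => hj /= h1 _.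
  by have -> : i + j = N.+1 by lia.
exists (odd N.+1); split=> c.
  rewrite ffunE; case: hasP => [[x _ /andP[/cornerE -> /eqP <-]]|no].
    by rewrite eqxx.
  case: eqP => // ce; case: no.
  have [y yD cy] := exists_corner (valP c); exists y => //.
  by rewrite cy (cornerE y) // ce eqxx.
move=> cc; rewrite ffunE; case: hasP => // -[]; exists (val c) => //.
  exact: valP.
by rewrite cc eqxx.
Qed.

Local Open Scope ring_scope.

Definition Bval (R : realType) (a b : nat) (n : int) : R :=
  if n is Posz k then zeta_ab R a b (staircase k.+1) (staircase k.-1) else 0.

(* Below, [j : 'I_N] encodes the 1-based index j.+1. *)
Definition J0 (N : nat) (mu : seq nat) : {set 'I_N} :=
  [set j : 'I_N | odd (N + j.+1)%N != odd (part mu j.+1)].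

Definition J1 (N : nat) (mu : seq nat) : {set 'I_N} :=
  [set j : 'I_N | odd (N + j.+1)%N == odd (part mu j.+1)].

Definition mval (N : nat) (mu : seq nat) (j : 'I_N) : nat :=
  if j \in J0 N mu then ((N + j.+1 - 1 - part mu j.+1) %/ 2)%N
  else ((N + j.+1 - 2 - part mu j.+1) %/ 2)%N.

Definition lval (N : nat) (mu : seq nat) : nat :=
  (\sum_(j in J0 N mu) (mval mu j + j.+1 + 1))%N.

Definition Bmx (R : realType) (a b N : nat) (mu : seq nat) : 'M[R]_N :=
  \matrix_(i < N, j < N)
    let e : int := (mval mu j)%:Z - (i.+1)%:Z + 1 in (-1) ^ e * Bval R a b e.

Definition kept_rows (N : nat) (mu : seq nat) : {set 'I_N} :=
  [set i : 'I_N | [forall j in J0 N mu, i.+1 != (mval mu j).+1]].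

(* [card_kept_rows] shows that the default value of [nth] is never used for
   the [mu] of interest; [enum] lists indices in increasing order. *)
Definition Fmx (R : realType) (a b N : nat) (mu : seq nat) :
  'M[R]_#|J1 N mu| :=
  mxsub (fun p : 'I_#|J1 N mu| => nth (enum_val p) (enum (kept_rows N mu)) p)
        (fun q : 'I_#|J1 N mu| => enum_val q)
        (Bmx R a b N mu).

Lemma card_kept_rows (N : nat) (mu : seq nat) :
  sorted geq mu ->
  (forall j, (1 <= j <= N)%N -> (part mu j < N.+1 - j)%N) ->
  #|kept_rows N mu| = #|J1 N mu|.
Proof.
move=> smu hmu.
have mono i j : (i <= j)%N -> (part mu j.+1 <= part mu i.+1)%N.
  move=> ij; rewrite /part /=; have [hj|hj] := ltnP j (size mu); last first.
    by rewrite nth_default.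
  have tr : transitive geq by move=> x y z /=; lia.
  have := sorted_leq_nth tr (fun x => leqnn x) 0%N smu.
  by apply; rewrite ?inE //; lia.
have mE j : j \in J0 N mu -> (2 * mval mu j = N + j - part mu j.+1)%N.
  move=> jJ; rewrite /mval jJ; move: jJ; rewrite inE.
  by have := hmu j.+1; have := ltn_ord j; lia.
have mlt j : j \in J0 N mu -> (mval mu j < N)%N.
  by move=> /mE; have := ltn_ord j; lia.
pose f (j : 'I_N) : 'I_N := insubd j (mval mu j).
have fE j : j \in J0 N mu -> f j = mval mu j :> nat.
  by move=> jJ; rewrite /f val_insubd mlt.
have finj : {in J0 N mu &, injective f}.
  move=> i j iJ jJ /(congr1 val) /=; rewrite !fE // => E; apply: val_inj => /=.
  have := mE _ iJ; have := mE _ jJ; rewrite E.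
  have := hmu i.+1; have := hmu j.+1; have := ltn_ord i; have := ltn_ord j.
  by case: (leqP i j) => ij; [have := mono i j ij | have := mono j i (ltnW ij)];
    lia.
have -> : kept_rows N mu = ~: (f @: (J0 N mu)).
  apply/setP => i; rewrite !inE; apply/forall_inP/idP => [h|/imsetP h j jJ].
    by apply/imsetP => -[j jJ E]; have := h j jJ; rewrite E fE // eqxx.
  apply/eqP => -[E]; apply: h; exists j => //; apply: val_inj => /=.
  by rewrite fE.
have -> : J1 N mu = ~: J0 N mu by apply/setP => j; rewrite !inE negbK.
by have := cardsC (f @: (J0 N mu)); have := cardsC (J0 N mu);
  rewrite card_in_imset // => <- /addnI.
Qed.

(* Main.v *)
(** The weight of a cell depends only on the parity of its content, so the
    truncated sums, with entries at most [M], satisfy Jacobi-Trudi identities: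
    with [e n] and [h n] the truncated sums over a single column or row of
    length [n] ending in a corner, the sum for [delta_N / mu] is both
    [det (e (N - 2 i - mu'_j + j))] and [det (h (N - 2 i - mu_j + j))]. These
    are proved by removing the smallest entry: its cells form a strip, and the
    expansion of the determinant over its rows produces the same strips, all
    other terms having repeated rows or a large block of zeros.
    Because the outer shape is a staircase, column [j] of the determinant
    involves only even or only odd indices. If [y] is the power series quotient
    of the odd part by the even part, a unitriangular Toeplitz factor splits off
    and leaves unit columns for [j] in [J0] and shifts of [y] for [j] in [J1].
    For [delta_{n+1} / delta_{n-1}] this determinant is [(-1)^n y n], so [y] is
    given by [B]. Finally [M] tends to infinity; the truncated sums are bounded
    since [e n <= 2] for every [M]. *)
Require Import Defs.
From HB Require Import structures.
From mathcomp Require Import all_boot all_order all_algebra.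
From mathcomp Require Import all_classical all_reals all_analysis.
From mathcomp Require Import perm zify ring lra.
Set Implicit Arguments.
Unset Strict Implicit.
Unset Printing Implicit Defensive.
Import Order.TTheory GRing.Theory Num.Theory.
Local Open Scope ring_scope.

(** * General determinant identities *)

Section Determinants.
Variable R : comNzRingType.

(** By pigeonhole every permutation sends one of the [j.+1] rows up to [j] to a column at or beyond
    [j], since only [j] columns come before; so each Leibniz term has a zero factor. *)
Lemma det_zero_block (N : nat) (A : 'M[R]_N) (j : 'I_N) :
  (forall p i : 'I_N, (p <= j <= i)%N -> A p i = 0) -> \det A = 0.
Proof.
move=> A0; rewrite /determinant big1 // => s _.
suff [p pj jsp] : exists2 p : 'I_N, (p <= j)%N & (j <= s p)%N.
  by rewrite (bigD1 p) //= A0 ?pj // mul0r mulr0.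
apply/exists_inP; apply: contraT; rewrite negb_exists_in => /forall_inP H.
pose f (p : 'I_j.+1) := s (widen_ord (ltn_ord j) p).
have fj p : (f p < j)%N by rewrite ltnNge H //= -ltnS.
have /leq_card : injective (fun p => Ordinal (fj p)).
  by move=> p q /(congr1 val) /= /val_inj /perm_inj /(congr1 val) /= /val_inj.
by rewrite !card_ord ltnn.
Qed.

Lemma det_sum_rows (N : nat) (T : finType) (P : 'I_N -> pred T)
    (w : 'I_N -> T -> R) (G : 'I_N -> T -> 'I_N -> R) :
  \det (\matrix_(j, i) \sum_(e | P j e) w j e * G j e i)
  = \sum_(c : {ffun 'I_N -> T} | [forall j, P j (c j)])
      (\prod_j w j (c j)) * \det (\matrix_(j, i) G j (c j) i).
Proof.
rewrite /determinant.
under eq_bigr => s _.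
  under eq_bigr do rewrite mxE.
  rewrite bigA_distr_big_dep mulr_sumr.
  over.
rewrite exchange_big /=; apply: eq_big => [c|c _].
  by apply/familyP/forallP => H j; have := H j; rewrite unfold_in.
rewrite mulr_sumr; apply: eq_bigr => s _.
rewrite big_split /= mulrCA; congr (_ * (_ * _)).
by apply: eq_bigr => j _; rewrite mxE.
Qed.

(** All rows are changed at once: [B = L *m A] with [L] lower unitriangular, supported on two
    diagonals. *)
Lemma det_sub_prev_row (N : nat) (A B : 'M[R]_N) (k : 'I_N -> R) :
  (forall j i : 'I_N, j = 0 :> nat -> B j i = A j i) ->
  (forall l j i : 'I_N, l.+1 = j :> nat -> B j i = A j i - k j * A l i) ->
  \det B = \det A.
Proof.
move=> B0 BS.
pose L : 'M[R]_N := \matrix_(j, l)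
  (if l == j then 1 else if l.+1 == j :> nat then - k j else 0).
have -> : B = L *m A.
  apply/matrixP => j i; rewrite mxE (bigD1 j) //= !mxE eqxx mul1r.
  have [j0|jN0] := eqVneq (j : nat) 0%N.
    rewrite B0 // big1 ?addr0 // => l lj; rewrite !mxE (negbTE lj).
    by rewrite j0 mul0r.
  have lt_l : (j.-1 < N)%N by have := ltn_ord j; lia.
  pose l := Ordinal lt_l; have lE : l.+1 = j :> nat by rewrite /=; lia.
  have lj : l != j by apply/eqP => /(congr1 val) /=; lia.
  rewrite (BS l) // (bigD1 l) //= !mxE (negbTE lj).
  rewrite lE eqxx mulNr big1 ?addr0 // => p /andP[pj pl].
  rewrite !mxE (negbTE pj) ifN ?mul0r //; apply: contra pl => /eqP E.
  by apply/eqP/val_inj => /=; lia.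
rewrite det_mulmx det_trig; last first.
  apply/is_trig_mxP => j l jl; rewrite mxE -val_eqE /=.
  by rewrite !ifN //; lia.
by rewrite big1 ?mul1r // => j _; rewrite mxE eqxx.
Qed.

End Determinants.

(** * Deleting unit columns, with rows and columns as lists of natural numbers *)

Definition minor (R : Type) (F : nat -> nat -> R) (n : nat) (r c : seq nat) :
  'M[R]_n := \matrix_(p, q) F (nth 0%N r p) (nth 0%N c q).

Definition rm_at (p : nat) (s : seq nat) := take p s ++ drop p.+1 s.

Lemma nth_rm_at p s q :
  (p < size s)%N -> nth 0%N (rm_at p s) q = nth 0%N s (bump p q).
Proof.
move=> ps; rewrite /rm_at nth_cat size_take ps /bump.
case: ltnP => qp; first by rewrite add0n nth_take.
by rewrite nth_drop; congr nth; lia.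
Qed.

Section UnitColumns.
Variable R : comNzRingType.

Lemma det_minor_unit_col (F : nat -> nat -> R) (n p q : nat) (r c : seq nat) :
  size r = n.+1 -> size c = n.+1 -> (p < n.+1)%N -> (q < n.+1)%N ->
  (forall i, (i < n.+1)%N -> F (nth 0%N r i) (nth 0%N c q) = (i == p)%:R) ->
  \det (minor F n.+1 r c)
  = (-1) ^+ (p + q) * \det (minor F n (rm_at p r) (rm_at q c)).
Proof.
move=> sr sc pn qn FU.
rewrite (expand_det_col _ (Ordinal qn)) (bigD1 (Ordinal pn)) //=.
rewrite big1 ?addr0 => [|i ip].
  rewrite mxE FU // eqxx mul1r /cofactor /=; congr (_ * \det _).
  by apply/matrixP => i j; rewrite !mxE !nth_rm_at ?sr ?sc.
by rewrite mxE FU // -[i == p :> nat]/(i == Ordinal pn) (negbTE ip) mul0r.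
Qed.

Lemma iota_split (m N : nat) :
  (m < N)%N -> iota 0 N = iota 0 m ++ m :: iota m.+1 (N - m.+1).
Proof.
by move=> mN; rewrite -[_ :: _]/(iota m (N - m.+1).+1) -iotaD; congr iota; lia.
Qed.

Lemma filter_iota_head (P : pred nat) (m N : nat) :
  (m < N)%N -> (forall i, (i <= m)%N -> P i) ->
  seq.filter P (iota 0 N) = iota 0 m ++ m :: seq.filter P (iota m.+1 (N - m.+1)).
Proof.
move=> mN Pm; rewrite (iota_split mN) filter_cat /= Pm //.
by congr (_ ++ _); apply/all_filterP/allP => i; rewrite mem_iota => ?; apply: Pm; lia.
Qed.

Lemma filter_iota_rm (P : pred nat) (m N : nat) :
  (m < N)%N -> (forall i, (i <= m)%N -> P i) ->
  seq.filter (fun i => P i && (i != m)) (iota 0 N) = rm_at m (seq.filter P (iota 0 N)).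
Proof.
move=> mN Pm; rewrite (filter_iota_head mN Pm) (iota_split mN) filter_cat /=.
rewrite eqxx andbF /rm_at take_size_cat ?size_iota // drop_cat size_iota.
rewrite ltnNge leqnSn subSnn /= drop0; congr (_ ++ _).
  by apply/all_filterP/allP => i; rewrite mem_iota => ?; rewrite Pm; lia.
by apply: eq_in_filter => i; rewrite mem_iota => ?; rewrite (_ : i != m) ?andbT; lia.
Qed.

Lemma nth_filter_iota (P : pred nat) (m N i : nat) :
  (m < N)%N -> (forall k, (k <= m)%N -> P k) -> (i <= m)%N ->
  nth 0%N (seq.filter P (iota 0 N)) i = i.
Proof.
move=> mN Pm im; rewrite (filter_iota_head mN Pm) nth_cat size_iota.
case: ltnP => h; first by rewrite nth_iota.
by have -> : i = m by [lia]; rewrite subnn.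
Qed.

Definition left_out (N : nat) (s : seq nat) := [seq i <- iota 0 N | i \notin s].

Lemma left_out_rcons (N m : nat) (s : seq nat) :
  all (gtn N) (rcons s m) -> all (ltn m) s ->
  left_out N (rcons s m) = rm_at m (left_out N s).
Proof.
rewrite all_rcons => /andP[mN _] /allP ms; rewrite -filter_iota_rm // => [|i im].
  by apply: eq_filter => i; rewrite mem_rcons inE negb_or andbC.
by apply/negP => /ms /=; lia.
Qed.

Lemma nth_left_out (N m i : nat) (s : seq nat) :
  (m < N)%N -> all (ltn m) s -> (i <= m)%N -> nth 0%N (left_out N s) i = i.
Proof.
move=> mN /allP ms im; apply: (nth_filter_iota mN) => // k km.
by apply/negP => /ms /=; lia.
Qed.

Lemma size_left_out (N : nat) (s : seq nat) :
  pairwise (fun x y => y < x)%N s -> all (gtn N) s ->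
  (size (left_out N s) + size s = N)%N.
Proof.
elim/last_ind: s => [|s m IH]; first by rewrite /left_out filter_predT size_iota addn0.
rewrite pairwise_rcons => /andP[ms ps] sN; rewrite left_out_rcons //.
move: sN; rewrite all_rcons => /andP[mN sN]; have := IH ps sN.
have : (m < size (left_out N s))%N.
  rewrite /left_out (filter_iota_head (m := m)) // ?size_cat ?size_iota /=; first by lia.
  by move=> i im; apply/negP => /(allP ms) /=; lia.
by rewrite /rm_at size_cat size_take size_drop size_rcons => h; rewrite h; lia.
Qed.

(* The pairs (row, column) are removed in decreasing order, so that every entry
   still sits at its original place when it is removed. *)
Lemma det_unit_cols (F : nat -> nat -> R) (N : nat) (s : seq (nat * nat)) :
  pairwise (fun x y => y < x)%N (unzip1 s) -> all (gtn N) (unzip1 s) ->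
  pairwise (fun x y => y < x)%N (unzip2 s) -> all (gtn N) (unzip2 s) ->
  (forall p i, p \in s -> (i < N)%N -> F i p.2 = (i == p.1)%:R) ->
  \det (\matrix_(i < N, j < N) F i j)
  = (-1) ^+ (\sum_(p <- s) (p.1 + p.2))
    * \det (minor F (N - size s) (left_out N (unzip1 s)) (left_out N (unzip2 s))).
Proof.
elim/last_ind: s => [|s [m j] IH].
  move=> _ _ _ _ _; rewrite big_nil mul1r subn0; congr (\det _).
  by apply/matrixP => p q; rewrite !mxE /left_out !filter_predT !nth_iota.
rewrite /unzip1 /unzip2 !map_rcons -!/(unzip1 _) -!/(unzip2 _) /=.
move=> p1 a1 p2 a2 FU; rewrite !left_out_rcons; first last.
- by move: p1; rewrite pairwise_rcons => /andP[].
- by [].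
- by move: p2; rewrite pairwise_rcons => /andP[].
- by [].
move: p1 a1 p2 a2; rewrite !pairwise_rcons !all_rcons.
move=> /andP[m1 p1] /andP[mN a1] /andP[j1 p2] /andP[jN a2].
rewrite /= in mN jN; rewrite IH // => [|p i ps]; last by apply: FU; rewrite mem_rcons inE ps orbT.
have := size_left_out p1 a1; have := size_left_out p2 a2; rewrite !size_map.
set r := left_out N (unzip1 s); set c := left_out N (unzip2 s) => sc sr.
have nr i : (i <= m)%N -> nth 0%N r i = i by apply: nth_left_out.
have nc i : (i <= j)%N -> nth 0%N c i = i by apply: nth_left_out.
(* If [m] were out of range, the default value of [nth] would force [m = 0] and an empty [r], but
   row 0 has not been removed yet. *)
have mr : (m < size r)%N.
  case: ltnP => // h; have := nr m (leqnn m); rewrite nth_default // => m0.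
  have : 0%N \in r.
    rewrite mem_filter mem_iota; apply/andP; split; last by lia.
    by apply/negP => /(allP m1) /=; lia.
  by move: h; rewrite -m0; case: (r).
have jc : (j < size c)%N.
  case: ltnP => // h; have := nc j (leqnn j); rewrite nth_default // => m0.
  have : 0%N \in c.
    rewrite mem_filter mem_iota; apply/andP; split; last by lia.
    by apply/negP => /(allP j1) /=; lia.
  by move: h; rewrite -m0; case: (c).
have [n nE] : exists n, (N - size s = n.+1)%N by exists (N - size s).-1; lia.
rewrite size_rcons subnS nE /=.
have szr : size r = n.+1 by rewrite -nE -{1}sr addnK.
have szc : size c = n.+1 by rewrite -nE -{1}sc addnK.
rewrite szr in mr; rewrite szc in jc.
rewrite (@det_minor_unit_col _ n m j) //; last first.
  move=> i iN; rewrite nc // (FU (m, j)) ?mem_rcons ?inE ?eqxx //=; last first.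
    have : nth 0%N r i \in r by apply: mem_nth; rewrite szr.
    by rewrite mem_filter mem_iota add0n => /andP[].
  rewrite -{1}(nr m) // nth_uniq ?szr //.
  exact: (filter_uniq _ (iota_uniq _ _)).
by rewrite -cats1 big_cat big_seq1 /= mulrA -exprD.
Qed.

End UnitColumns.

(** * Partitions inside the staircase, and strips *)

Definition shape (N : nat) (c : 'I_N -> nat) : bool :=
  [forall j, (c j + j <= N)%N]
  && [forall l : 'I_N, forall j : 'I_N, (l.+1 == j) ==> (c j <= c l)%N].

Lemma nonincreasing_of_consecutive (N : nat) (c : 'I_N -> nat) :
  (forall l j : 'I_N, l.+1 = j :> nat -> c j <= c l)%N ->
  forall l j : 'I_N, (l <= j)%N -> (c j <= c l)%N.
Proof.
move=> cS l j; move: {2}(j - l)%N (erefl (j - l)%N) => d.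
elim: d j => [|d IH] j jl lj; first by have -> : j = l by apply: val_inj => /=; lia.
have jN : (j.-1 < N)%N by have := ltn_ord j; lia.
apply: (leq_trans (cS (Ordinal jN) j _)) => /=; first by lia.
by apply: IH => /=; lia.
Qed.

Lemma shapeP (N : nat) (c : 'I_N -> nat) :
  reflect ((forall j, c j + j <= N)%N
           /\ (forall l j : 'I_N, (l <= j)%N -> (c j <= c l)%N)) (shape c).
Proof.
apply: (iffP andP) => [[/forallP cN /forallP cS]|[cN cD]]; split=> //.
- apply: nonincreasing_of_consecutive => l j /eqP lj.
  by have /forallP/(_ j)/implyP := cS l; apply.
- exact/forallP.
- apply/forallP => l; apply/forallP => j; apply/implyP => /eqP lj.
  by apply: cD; rewrite -lj.
Qed.

(* In the diagram with row lengths [c], strips are vertical if [b] and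
   horizontal otherwise; the row above row 0 counts as having length [N]. *)
Definition strip_ub (b : bool) (N : nat) (c : 'I_N -> nat) (j : 'I_N) : nat :=
  if b then (c j).+1 else if j == 0 :> nat then N else c (ord_pred j).

(** Nothing forces [c'] to be nonincreasing: a strip is an independent choice in each row, which is
    what expanding a determinant over its rows produces. *)
Definition strip (b : bool) (N : nat) (c c' : 'I_N -> nat) : bool :=
  [forall j, (c j <= c' j < (strip_ub b c j).+1)%N].

Lemma ord_pred_succ (N : nat) (l j : 'I_N) : l.+1 = j :> nat -> ord_pred j = l.
Proof.
move=> lj; apply: val_inj; rewrite /= -lj addSn /= modnDr modn_small //.
Qed.

(** The bound [N.+2] leaves room for the length [N.+1], which a vertical strip may reach. *)
Definition lens (N : nat) (c : {ffun 'I_N -> 'I_N.+2}) : 'I_N -> nat :=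
  fun j => c j.

Lemma big_ord_range (T : Type) (idx : T) (op : Monoid.law idx) (n lo hi : nat)
    (F : nat -> T) : (hi <= n)%N ->
  \big[op/idx]_(e < n | (lo <= e < hi)%N) F e = \big[op/idx]_(lo <= e < hi) F e.
Proof.
move=> hn; rewrite -(big_mkord (fun e => lo <= e < hi)%N F).
rewrite [RHS](big_nat_widenl _ 0%N) // [RHS](big_nat_widen _ _ _ _ _ hn).
by apply: eq_bigl => e; rewrite andbC.
Qed.

(** * Jacobi-Trudi determinants and their expansion over strips *)

Section JacobiTrudi.
Variables (R : comNzRingType).
Implicit Types (f x : nat -> R).

Definition shifted f (n k : nat) : R := if (k <= n)%N then f (n - k)%N else 0.

(** The Jacobi-Trudi index [lambda_i - i - c_j + j] for [lambda_i = N - i], counted from 0; matrix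
    row [j] belongs to row [j] of the inner shape [c]. *)
Definition JT (N : nat) f (c : 'I_N -> nat) : 'M[R]_N :=
  \matrix_(j < N, i < N) shifted f (N + j) (c j + i.*2).

(* If [f n] sums over the columns of length [n] whose bottom cell is a corner,
   with entries larger than [v], then [estep (X v) f n] also allows the entry
   [v]: it sits in the top cell, the weight of which depends on [n] only.
   Likewise [hstep] for rows, where [v] may be repeated. *)
Definition estep x f (n : nat) : R :=
  f n + (if n is m.+1 then x n * f m else 0).

Fixpoint hstep x f (n : nat) : R :=
  if n is m.+1 then f n + x n * hstep x f m else f 0%N.

Definition bstep (b : bool) := if b then estep else hstep.

Definition strip_weight x (N : nat) (c c' : 'I_N -> nat) : R :=
  \prod_(j < N) \prod_(c j <= k < c' j) x (N + j + k)%N.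

(** From column [j] on, the row that leaves the staircase and all rows above it have negative
    indices, so [det_zero_block] applies. *)
Lemma det_JT_out (N : nat) f (c : 'I_N -> nat) (j : 'I_N) :
  (forall l : 'I_N, (l <= j)%N -> (c j <= c l)%N) -> (N < c j + j)%N ->
  \det (JT f c) = 0.
Proof.
move=> cD cN; apply: (det_zero_block (j := j)) => p i /andP[pj ji].
by rewrite mxE /shifted ifN //; have := cD p pj; lia.
Qed.

(** A matrix row depends on [j - c j] only, so a row one cell longer than the row above repeats
    it. *)
Lemma det_JT_repeated (N : nat) f (c : 'I_N -> nat) (l j : 'I_N) :
  l.+1 = j :> nat -> c j = (c l).+1 -> \det (JT f c) = 0.
Proof.
move=> lj cj; apply: (@determinant_alternate _ _ _ l j) => [|i].
  by apply/eqP => /(congr1 val) /=; lia.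
by rewrite !mxE cj -lj addnS addSn /shifted subSS.
Qed.

(** The base of the recursion, where no entry is available and only the empty diagram counts. Since
    [c j + j <= N], the nonzero entries lie on or above the diagonal. *)
Lemma det_JT_pred1 (N : nat) (c : 'I_N -> nat) : shape c ->
  \det (JT (fun n => (n == 0)%N%:R) c) = [forall j, c j + j == N]%N%:R.
Proof.
move=> /shapeP[cN _]; rewrite -det_tr det_trig; last first.
  apply/is_trig_mxP => i j ij; rewrite !mxE /shifted; case: leqP => // h.
  by rewrite (_ : (_ == _) = false) //; have := cN j; lia.
case: (boolP [forall j, _]) => [/forallP cE|].
  rewrite big1 // => j _; rewrite !mxE /shifted; have := cE j.
  by case: leqP => ? ?; [rewrite (_ : (_ == _) = true) //; lia | lia].
rewrite negb_forall => /existsP[j cj]; rewrite (bigD1 j) //= !mxE /shifted.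
case: leqP => h; last by rewrite mul0r.
by rewrite (_ : (_ == _) = false) ?mul0r //; have := cN j; lia.
Qed.

Section Step.
Variables (x : nat -> R) (hx : forall m n, odd m = odd n -> x m = x n).

(** The weight is taken at [n + k], of the same parity as [n - k], to avoid truncated
    subtraction. *)
Lemma shifted_estep f n k :
  shifted (estep x f) n k = shifted f n k + x (n + k)%N * shifted f n k.+1.
Proof.
rewrite /shifted; case: ltngtP => [kn|kn|->].
- rewrite subnS; case E: (n - k)%N => [|d]; first by lia.
  by rewrite /= /estep; congr (_ + _ * _); apply: hx; lia.
- by rewrite mulr0 addr0.
- by rewrite subnn mulr0 addr0 /estep addr0.
Qed.

Lemma shifted_hstep f n k :
  shifted (hstep x f) n k
  = shifted f n k + x (n + k)%N * shifted (hstep x f) n k.+1.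
Proof.
rewrite /shifted; case: ltngtP => [kn|kn|->].
- rewrite subnS; case E: (n - k)%N => [|d]; first by lia.
  by rewrite /=; congr (_ + _ * _); apply: hx; lia.
- by rewrite mulr0 addr0.
- by rewrite subnn mulr0 addr0.
Qed.

Lemma shifted_hstep_range f n i lo hi : (lo <= hi)%N ->
  shifted (hstep x f) n (lo + i.*2)
  = \sum_(lo <= e < hi)
      (\prod_(lo <= k < e) x (n + k)%N) * shifted f n (e + i.*2)
    + (\prod_(lo <= k < hi) x (n + k)%N) * shifted (hstep x f) n (hi + i.*2).
Proof.
elim: hi => [|hi IH].
  by rewrite leqn0 => /eqP ->; rewrite !big_geq // mul1r add0r.
rewrite leq_eqVlt => /predU1P[->|lh]; first by rewrite !big_geq // mul1r add0r.
rewrite IH // !big_nat_recr //= -addrA; congr (_ + _).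
rewrite shifted_hstep mulrDr -mulrA addSn; congr (_ + _ * (_ * _)).
by apply: hx; lia.
Qed.

(** For [estep] each row is already a sum of two terms. For [hstep] the sum along row [j] is cut at
    the length of the row above: its tail is a multiple of the previous matrix row, which
    [det_sub_prev_row] removes. *)
Lemma det_JT_bstep_strip b (N : nat) f (c : 'I_N -> nat) : shape c ->
  \det (JT (bstep b x f) c)
  = \sum_(c' : {ffun 'I_N -> 'I_N.+2} | strip b c (lens c'))
      strip_weight x c (lens c') * \det (JT f (lens c')).
Proof.
move=> /shapeP[cN cD].
rewrite -(@det_sum_rows _ _ _
  (fun j (e : 'I_N.+2) => (c j <= e < (strip_ub b c j).+1)%N)
  (fun j e => \prod_(c j <= k < e) x (N + j + k)%N)
  (fun j e i => shifted f (N + j) (e + i.*2))).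
have ubN j : (strip_ub b c j < N.+2)%N.
  rewrite /strip_ub; have := cN j; have := cN (ord_pred j).
  by case: b; [|case: ifP]; lia.
have sumE j i : \sum_(e < N.+2 | (c j <= e < (strip_ub b c j).+1)%N)
    (\prod_(c j <= k < e) x (N + j + k)%N) * shifted f (N + j) (e + i.*2)
  = \sum_(c j <= e < (strip_ub b c j).+1)
    (\prod_(c j <= k < e) x (N + j + k)%N) * shifted f (N + j) (e + i.*2).
  exact: (@big_ord_range _ _ _ _ _ _ (fun e =>
    (\prod_(c j <= k < e) x (N + j + k)%N) * shifted f (N + j) (e + i.*2))).
case: b ubN sumE => ubN sumE.
  congr (\det _); apply/matrixP => j i; rewrite !mxE sumE /= shifted_estep.
  rewrite big_nat_recr //= big_nat1 big_geq // mul1r big_nat1.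
  by congr (_ + _ * _); apply: hx; lia.
symmetry; apply: (det_sub_prev_row
    (k := fun j => \prod_(c j <= k < (c (ord_pred j)).+1) x (N + j + k)%N)).
  move=> j i j0; rewrite !mxE sumE /strip_ub /= j0 eqxx addn0.
  (* In row 0 the tail starts beyond [N], hence vanishes by itself. *)
  rewrite (@shifted_hstep_range _ _ _ (c j) N.+1); last by have := cN j; lia.
  rewrite [X in _ * X]/shifted [in X in _ * X]ifN ?mulr0 ?addr0 //; lia.
move=> l j i lj; rewrite !mxE sumE /strip_ub /= (ord_pred_succ lj) ifN; last by lia.
have clj : (c j <= c l)%N by apply: cD; rewrite -lj.
rewrite (@shifted_hstep_range _ _ _ (c j) (c l).+1); last by lia.
rewrite (_ : shifted (hstep x f) (N + j) _ = shifted (hstep x f) (N + l) (c l + i.*2)).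
  by rewrite addrK.
by rewrite -lj addnS addSn /shifted subSS.
Qed.

(** The other strips contribute zero: where the new lengths increase they do so by exactly one,
    which repeats a row, and nonincreasing lengths that leave the staircase give a zero block. *)
Lemma det_JT_bstep b (N : nat) f (c : 'I_N -> nat) : shape c ->
  \det (JT (bstep b x f) c)
  = \sum_(c' : {ffun 'I_N -> 'I_N.+2} | strip b c (lens c') && shape (lens c'))
      strip_weight x c (lens c') * \det (JT f (lens c')).
Proof.
move=> sc; rewrite det_JT_bstep_strip // [RHS]big_mkcondr /=.
apply: eq_bigr => c' /forallP cc'; case: ifPn => // ns.
have [cN cD] := shapeP _ sc.
suff -> : \det (JT f (lens c')) = 0 by rewrite mulr0.
case: (boolP [forall l : 'I_N, forall j : 'I_N, (l.+1 == j) ==> (lens c' j <= lens c' l)%N]).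
  move=> D; have /existsP[j cj] : [exists j, ~~ (lens c' j + j <= N)%N].
    by rewrite -negb_forall; move: ns; rewrite /shape D andbT.
  apply: (@det_JT_out _ _ _ j); last by rewrite ltnNge.
  move=> l; apply: (nonincreasing_of_consecutive (c := lens c')) => l1 j1 lj.
  by have /forallP/(_ l1)/forallP/(_ j1)/implyP := D; apply; apply/eqP.
rewrite negb_forall => /existsP[l]; rewrite negb_forall => /existsP[j].
rewrite negb_imply => /andP[/eqP lj clj]; apply: (det_JT_repeated _ lj).
have /andP[cl _] := cc' l; have := cc' j; rewrite /strip_ub (ord_pred_succ lj).
have : (c j <= c l)%N by apply: cD; rewrite -lj.
by case: (b); [lia | rewrite ifN; lia].
Qed.

End Step.
End JacobiTrudi.

(** * Peeling the strip of smallest entries off a filling *)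

Lemma find_downset (N : nat) (P : pred 'I_N) :
  (forall k k' : 'I_N, (k <= k')%N -> P k' -> P k) ->
  forall k : 'I_N, (k < find (predC P) (enum 'I_N))%N = P k.
Proof.
move=> PD k; apply/idP/idP => [h|Pk].
  by have := before_find k h; rewrite nth_ord_enum /= => /negbFE.
rewrite ltnNge; apply/negP => h.
have /(nth_find k) : has (predC P) (enum 'I_N).
  by rewrite has_find size_enum_ord (leq_ltn_trans h).
have mN : (find (predC P) (enum 'I_N) < N)%N by rewrite (leq_ltn_trans h).
rewrite -[X in nth _ _ X]/(val (Ordinal mN)) nth_ord_enum /= => /negP; apply.
exact: PD Pk.
Qed.

Definition in_skew (N : nat) (c : 'I_N -> nat) (p : 'I_N * 'I_N) : bool :=
  (c p.1 <= p.2)%N && (p.1 + p.2 < N)%N.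

(* Fillings of the staircase minus [c] with entries in ]v, M], padded with 0.
   Rows are strict and columns weak if [b], and conversely otherwise. *)
Definition bfill (N M : nat) (b : bool) (v : nat) (c : 'I_N -> nat)
    (t : {ffun 'I_N * 'I_N -> 'I_M.+1}) : bool :=
  [&& [forall p, ~~ in_skew c p ==> (t p == 0 :> nat)],
      [forall p, in_skew c p ==> (v < t p)%N],
      [forall p, forall q, [&& in_skew c p, in_skew c q, p.1 == q.1
        & (p.2 < q.2)%N] ==> (t p + b <= t q)%N]
    & [forall p, forall q, [&& in_skew c p, in_skew c q, p.2 == q.2
        & (p.1 < q.1)%N] ==> (t p + ~~ b <= t q)%N]].

Lemma bfillP (N M : nat) (b : bool) (v : nat) (c : 'I_N -> nat)
    (t : {ffun 'I_N * 'I_N -> 'I_M.+1}) :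
  reflect
    [/\ forall p, ~~ in_skew c p -> t p = 0 :> nat,
        forall p, in_skew c p -> (v < t p)%N,
        forall p q, in_skew c p -> in_skew c q -> p.1 = q.1 -> (p.2 < q.2)%N ->
          (t p + b <= t q)%N
      & forall p q, in_skew c p -> in_skew c q -> p.2 = q.2 -> (p.1 < q.1)%N ->
          (t p + ~~ b <= t q)%N]
    (bfill b v c t).
Proof.
apply: (iffP and4P) => -[h1 h2 h3 h4]; split.
- by move=> p np; have /forallP/(_ p)/implyP/(_ np)/eqP := h1.
- by move=> p np; have /forallP/(_ p)/implyP/(_ np) := h2.
- move=> p q hp hq /eqP e l; have /forallP/(_ p)/forallP/(_ q)/implyP := h3.
  by apply; apply/and4P.
- move=> p q hp hq /eqP e l; have /forallP/(_ p)/forallP/(_ q)/implyP := h4.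
  by apply; apply/and4P.
- by apply/forallP => p; apply/implyP => /h1 ->.
- by apply/forallP => p; apply/implyP => /h2 ->.
- apply/forallP => p; apply/forallP => q; apply/implyP => /and4P[hp hq /eqP e l].
  exact: h3.
- apply/forallP => p; apply/forallP => q; apply/implyP => /and4P[hp hq /eqP e l].
  exact: h4.
Qed.

Section Peel.
Variables (N M : nat) (b : bool) (v : nat) (vM : (v < M)%N).
Variables (c : 'I_N -> nat) (sc : shape c).
Notation T := {ffun 'I_N * 'I_N -> 'I_M.+1}.

(** Row lengths of the inner shape enlarged by the cells that hold [v.+1]. The zeros padding the
    inner shape count as low; the test [j + k < N] discards those outside the staircase. *)
Definition low_len (t : T) : {ffun 'I_N -> 'I_N.+2} :=
  [ffun j : 'I_N => inord (find (predC (fun k : 'I_N =>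
     (j + k < N) && (t (j, k) <= v.+1))%N) (enum 'I_N))].

Lemma low_lenE (t : T) (j k : 'I_N) : bfill b v c t ->
  (k < lens (low_len t) j)%N = ((j + k < N) && (t (j, k) <= v.+1))%N.
Proof.
move=> /bfillP[h1 h2 h3 _]; rewrite /lens ffunE inordK; last first.
  by rewrite (leq_ltn_trans (find_size _ _)) // size_enum_ord; lia.
apply: (find_downset (P := fun k : 'I_N => (j + k < N) && (t (j, k) <= v.+1))%N).
move=> i i' ii' /andP[ji' ti']; apply/andP; split; first by lia.
have [hi|/h1 ->] := boolP (in_skew c (j, i)); last by [].
have [E|ne] := eqVneq i i'; first by rewrite E.
have hi' : in_skew c (j, i') by move: hi; rewrite /in_skew /=; lia.
have lti : (i < i')%N by rewrite ltn_neqAle ii' andbT.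
by have := h3 (j, i) (j, i') hi hi' erefl lti; lia.
Qed.

(** Entries equal to [v.+1] cannot share a row if [b], nor a column otherwise, which is the bound
    [strip_ub]; monotonicity in the columns makes the lengths nonincreasing. *)
Lemma low_len_strip (t : T) : bfill b v c t ->
  strip b c (lens (low_len t)) && shape (lens (low_len t)).
Proof.
move=> bt; have [h1 h2 h3 h4] := bfillP _ _ _ _ bt.
have LE j k := @low_lenE t j k bt.
have [cN cD] := shapeP _ sc.
set m := lens (low_len t) in LE *.
have mN j : (m j <= N)%N.
  rewrite /m /lens ffunE inordK; last first.
    by rewrite (leq_ltn_trans (find_size _ _)) // size_enum_ord; lia.
  by rewrite (leq_trans (find_size _ _)) // size_enum_ord.
have mNj j : (m j + j <= N)%N.
  case E: (m j) => [|k]; first by have := ltn_ord j; lia.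
  have kN : (k < N)%N by have := mN j; lia.
  by have := LE j (Ordinal kN); rewrite E /= ltnSn; lia.
apply/andP; split; last first.
  apply/shapeP; split=> //; apply: nonincreasing_of_consecutive => l j lj.
  case E: (m j) => [|k] //.
  have kN : (k < N)%N by have := mN j; lia.
  have := LE j (Ordinal kN); rewrite E /= ltnSn => /esym/andP[jk tk].
  have := LE l (Ordinal kN); rewrite /= => ->; apply/andP; split; first by lia.
  have [hl|/h1 ->] := boolP (in_skew c (l, Ordinal kN)); last by [].
  have hj : in_skew c (j, Ordinal kN).
    move: hl; rewrite /in_skew /=; have := cD l j; lia.
  have ltl : (l < j)%N by rewrite -lj.
  by have := h4 _ _ hl hj erefl ltl; lia.
apply/forallP => j; apply/andP; split.
  rewrite leqNgt; apply/negP => mc; have := cN j => cj.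
  have kN : (m j < N)%N by lia.
  have := LE j (Ordinal kN); rewrite /= ltnn h1 /=; first by lia.
  by rewrite /in_skew /=; lia.
rewrite /strip_ub ltnS; case Eb: b h3 h4 => h3 h4.
  rewrite leqNgt; apply/negP => mc; have := mNj j => mj.
  have k1N : (c j < N)%N by lia.
  have k2N : ((c j).+1 < N)%N by lia.
  have := LE j (Ordinal k2N); rewrite /= mc => /esym/andP[jk tk].
  have i1 : in_skew c (j, Ordinal k1N) by rewrite /in_skew /=; lia.
  have i2 : in_skew c (j, Ordinal k2N) by rewrite /in_skew /=; lia.
  have := h3 _ _ i1 i2 erefl (ltnSn _); have := h2 _ i1; rewrite /=; lia.
case: eqP => [_|j0]; first exact: mN.
have lN : (j.-1 < N)%N by have := ltn_ord j; lia.
pose l := Ordinal lN; have lj : l.+1 = j :> nat by rewrite /=; lia.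
rewrite (ord_pred_succ lj) leqNgt; apply/negP => mc; have := mNj j => mj.
(* Column [c l] would hold an entry above [v] in row [l] and one at most [v.+1] just below it,
   against strict columns. *)
have kN : (c l < N)%N by have := mN j; lia.
have := LE j (Ordinal kN); rewrite /= mc => /esym/andP[jk tk].
have i1 : in_skew c (l, Ordinal kN) by rewrite /in_skew /=; lia.
have i2 : in_skew c (j, Ordinal kN).
  by rewrite /in_skew /=; have := cD l j; rewrite -lj leqnSn => /(_ isT); lia.
have ltl : (l < j)%N by rewrite -lj.
by have := h4 _ _ i1 i2 erefl ltl; have := h2 _ i1; rewrite /=; lia.
Qed.

Variables (c' : {ffun 'I_N -> 'I_N.+2}).
Let m := lens c'.
Hypotheses (cc' : strip b c m) (sc' : shape m).

(** Together with [erase_strip], the bijection between fillings of [c'] with entries above [v.+1]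
    and fillings of [c] with entries above [v] whose smallest strip ends at [c']. *)
Definition fill_strip (t : T) : T :=
  [ffun p : 'I_N * 'I_N => if in_skew c p && (p.2 < m p.1)%N then inord v.+1 else t p].

Definition erase_strip (t : T) : T :=
  [ffun p : 'I_N * 'I_N => if (p.2 < m p.1)%N then ord0 else t p].

Let le_cm j : (c j <= m j)%N.
Proof. by have /forallP/(_ j)/andP[] := cc'. Qed.

Let inord_v : @inord M v.+1 = v.+1 :> nat.
Proof. by rewrite inordK. Qed.

Let skew_outer p : in_skew c p -> (m p.1 <= p.2)%N -> in_skew m p.
Proof. by rewrite /in_skew => /andP[_ ->] ->. Qed.

Lemma bfill_fill_strip (t : T) : bfill b v.+1 m t -> bfill b v c (fill_strip t).
Proof.
move=> /bfillP[h1 h2 h3 h4].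
have [cN cD] := shapeP _ sc; have [mN mD] := shapeP _ sc'.
apply/bfillP; split.
- move=> p np; rewrite ffunE (negbTE np) /=; apply: h1; move: np.
  by rewrite /in_skew; have := le_cm p.1; lia.
- move=> p ip; rewrite ffunE ip /=; case: (ltnP p.2 (m p.1)) => h; first by rewrite inord_v.
  by have := h2 p (skew_outer ip h); lia.
- move=> p q ip iq e l; rewrite !ffunE ip iq /=.
  case: (ltnP p.2 (m p.1)) => hp; case: (ltnP q.2 (m q.1)) => hq.
  + rewrite !inord_v; case Eb: b => /=; last by lia.
    have /forallP/(_ p.1) := cc'; rewrite /strip_ub Eb.
    move: ip iq hp hq; rewrite /in_skew -e; lia.
  + by rewrite inord_v; have := h2 q (skew_outer iq hq); case: (b) => /=; lia.
  + by move: hp hq; rewrite e; lia.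
  + by apply: h3 => //; apply: skew_outer.
- move=> p q ip iq e l; rewrite !ffunE ip iq /=.
  case: (ltnP p.2 (m p.1)) => hp; case: (ltnP q.2 (m q.1)) => hq.
  + rewrite !inord_v; case Eb: b => /=; first by lia.
    have /forallP/(_ q.1) := cc'; rewrite /strip_ub Eb ifN; last by lia.
    have lN : (q.1.-1 < N)%N by have := ltn_ord q.1; lia.
    have lj : (Ordinal lN).+1 = q.1 :> nat by rewrite /=; lia.
    rewrite (ord_pred_succ lj); have := cD p.1 (Ordinal lN).
    by move: ip iq hp hq; rewrite /in_skew /= -e; lia.
  + by rewrite inord_v; have := h2 q (skew_outer iq hq); case: (b) => /=; lia.
  + by move: hp hq; rewrite e; have := mD p.1 q.1; lia.
  + by apply: h4 => //; apply: skew_outer.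
Qed.

Lemma low_len_fill_strip (t : T) :
  bfill b v.+1 m t -> low_len (fill_strip t) = c'.
Proof.
move=> bt; have LE j k := @low_lenE _ j k (bfill_fill_strip bt).
have [h1 h2 _ _] := bfillP _ _ _ _ bt; have [mN mD] := shapeP _ sc'.
have E (j k : 'I_N) : (k < lens (low_len (fill_strip t)) j)%N = (k < m j)%N.
  rewrite LE ffunE /=; have := mN j => mj.
  case: (boolP (in_skew c (j, k))) => ip /=.
    case: (ltnP k (m j)) => h; first by rewrite inord_v leqnn; move: ip; rewrite /in_skew /=; lia.
    by have := h2 (j, k) (skew_outer ip h); lia.
  have := le_cm j => cmj; rewrite h1; last by move: ip; rewrite /in_skew /=; lia.
  by move: ip; rewrite /in_skew /=; lia.
apply/ffunP => j; apply: val_inj => /=.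
rewrite -[LHS]/(lens (low_len (fill_strip t)) j) -[RHS]/(m j).
have nN : (lens (low_len (fill_strip t)) j <= N)%N.
  rewrite /lens ffunE inordK; last first.
    by rewrite (leq_ltn_trans (find_size _ _)) // size_enum_ord; lia.
  by rewrite (leq_trans (find_size _ _)) // size_enum_ord.
have := mN j => mj.
case: (ltngtP (lens (low_len (fill_strip t)) j) (m j)) => // h.
- have kN : (lens (low_len (fill_strip t)) j < N)%N by lia.
  by have := E j (Ordinal kN); rewrite /= ltnn h.
- have kN : (m j < N)%N by lia.
  by have := E j (Ordinal kN); rewrite /= ltnn h.
Qed.

Lemma fill_stripK (t : T) : bfill b v.+1 m t -> erase_strip (fill_strip t) = t.
Proof.
move=> /bfillP[h1 _ _ _]; apply/ffunP => p; rewrite !ffunE.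
case: (ltnP p.2 (m p.1)) => h; last by rewrite andbF.
by apply: val_inj; rewrite /= h1 // /in_skew leqNgt h.
Qed.

Lemma erase_stripK (t : T) :
  bfill b v c t -> low_len t = c' -> fill_strip (erase_strip t) = t.
Proof.
move=> bt E; have LE p := @low_lenE _ p.1 p.2 bt.
have [h1 h2 _ _] := bfillP _ _ _ _ bt.
apply/ffunP => p; rewrite !ffunE; have := LE p; rewrite -surjective_pairing E -/m.
case: (boolP (in_skew c p)) => ip /=; case: (ltnP p.2 (m p.1)) => h //.
  move=> /esym/andP[_ tp]; apply: val_inj; rewrite /= inord_v.
  by apply/eqP; rewrite eqn_leq tp andbT; apply: h2.
by move=> _; apply: val_inj; rewrite /= h1.
Qed.

Lemma bfill_erase_strip (t : T) :
  bfill b v c t -> low_len t = c' -> bfill b v.+1 m (erase_strip t).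
Proof.
move=> bt E; have LE p := @low_lenE _ p.1 p.2 bt.
have [h1 h2 h3 h4] := bfillP _ _ _ _ bt.
have up p : in_skew m p -> in_skew c p.
  by rewrite /in_skew; have := le_cm p.1; lia.
have tE p : in_skew m p -> erase_strip t p = t p.
  by move=> ip; rewrite ffunE ifN //; move: ip; rewrite /in_skew; lia.
apply/bfillP; split.
- move=> p np; rewrite ffunE; case: (ltnP p.2 (m p.1)) => h //; apply: h1.
  by move: np; rewrite /in_skew; have := le_cm p.1; lia.
- move=> p ip; rewrite tE //; have := LE p; rewrite -surjective_pairing E -/m.
  by move: ip; rewrite /in_skew; lia.
- by move=> p q ip iq e l; rewrite !tE //; apply: h3 => //; apply: up.
- by move=> p q ip iq e l; rewrite !tE //; apply: h4 => //; apply: up.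
Qed.

End Peel.

(** * Truncated sums as Jacobi-Trudi determinants *)

Section FillingSums.
Variables (R : comNzRingType) (X : nat -> nat -> R).
Hypothesis hX : forall v m n, odd m = odd n -> X v m = X v n.

Definition fill_weight (N M : nat) (c : 'I_N -> nat)
    (t : {ffun 'I_N * 'I_N -> 'I_M.+1}) : R :=
  \prod_(p | in_skew c p) X (t p) (N + p.1 + p.2)%N.

Definition fill_sum (N M : nat) (b : bool) (v : nat) (c : 'I_N -> nat) : R :=
  \sum_(t : {ffun 'I_N * 'I_N -> 'I_M.+1} | bfill b v c t) fill_weight c t.

Lemma fill_sum_top (N M : nat) (b : bool) (c : 'I_N -> nat) : shape c ->
  fill_sum M b M c = [forall j, c j + j == N]%N%:R.
Proof.
move=> /shapeP[cN _]; case: (boolP [forall j, _]) => [/forallP cE|].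
  have nin p : in_skew c p = false.
    by rewrite /in_skew; have := eqP (cE p.1); lia.
  rewrite /fill_sum (bigD1 [ffun=> ord0]) /=; last first.
    by apply/bfillP; split=> [p _|p|p q|p q]; rewrite ?nin // ffunE.
  rewrite /fill_weight big_pred0 // big1 ?addr0 // => t /andP[/bfillP[h1 _ _ _]].
  by case/eqP; apply/ffunP => p; apply: val_inj; rewrite ffunE /= h1 ?nin.
rewrite negb_forall => /existsP[j cj]; rewrite /fill_sum big_pred0 // => t.
apply/negP => /bfillP[_ h2 _ _]; have cNj := cN j.
have kN : (c j < N)%N by lia.
have /h2 : in_skew c (j, Ordinal kN) by rewrite /in_skew /=; lia.
by rewrite ltnNge -ltnS ltn_ord.
Qed.

Lemma fill_weight_strip (N M : nat) (b : bool) (v : nat) (c : 'I_N -> nat)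
    (c' : {ffun 'I_N -> 'I_N.+2}) (t : {ffun 'I_N * 'I_N -> 'I_M.+1}) :
  (v < M)%N -> shape (lens c') -> strip b c (lens c') ->
  fill_weight c (fill_strip v c c' t)
  = strip_weight (X v.+1) c (lens c') * fill_weight (lens c') t.
Proof.
move=> vM /shapeP[mN _] /forallP cc'; rewrite /fill_weight.
rewrite (bigID (fun p : 'I_N * 'I_N => (p.2 < lens c' p.1)%N)) /=; congr (_ * _).
  rewrite /strip_weight.
  under [RHS]eq_bigr => j _.
    rewrite -(@big_ord_range _ _ _ N); last by have := mN j; lia.
    over.
  rewrite pair_big_dep /=; apply: eq_big => [p|p /andP[ip h]]; last first.
    by rewrite ffunE ip h inordK.
  rewrite /in_skew; have := mN p.1; have := cc' p.1; case: (ltnP p.2 (lens c' p.1)).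
    by move=> h /andP[h1 _] h2; rewrite !andbT; lia.
  by rewrite !andbF.
apply: eq_big => [p|p /andP[ip h]]; last by rewrite ffunE (negbTE h) andbF.
by rewrite /in_skew; have /andP[h _] := cc' p.1; lia.
Qed.

Lemma fill_sum_step (N M : nat) (b : bool) (v : nat) (c : 'I_N -> nat) :
  (v < M)%N -> shape c ->
  fill_sum M b v c
  = \sum_(c' : {ffun 'I_N -> 'I_N.+2} | strip b c (lens c') && shape (lens c'))
      strip_weight (X v.+1) c (lens c') * fill_sum M b v.+1 (lens c').
Proof.
move=> vM sc; rewrite /fill_sum.
rewrite (partition_big (low_len v) (fun c' => strip b c (lens c') && shape (lens c')));
  last by move=> t; apply: low_len_strip.
apply: eq_bigr => c' /andP[cc' sc'].
rewrite (reindex_onto (fill_strip v c c') (erase_strip c')); last first.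
  by move=> t /andP[bt /eqP]; apply: (erase_stripK vM sc bt).
rewrite mulr_sumr; apply: eq_big => [t|t _]; last first.
  by rewrite (fill_weight_strip _ vM sc' cc').
apply/andP/idP => [[/andP[bt /eqP E] /eqP <-]|bt].
  exact: (bfill_erase_strip vM sc cc').
split; last by rewrite (fill_stripK _ bt).
by rewrite (bfill_fill_strip vM sc cc' sc' bt) (low_len_fill_strip vM sc cc' sc' bt) /=.
Qed.

(** The sum over one line of [n] cells ending in a corner, with entries in []v, v + d]] that
    increase strictly if [b] and weakly otherwise. The smallest entry is added last. *)
Fixpoint iter_step (b : bool) (v d : nat) : nat -> R :=
  if d is d'.+1 then bstep b (X v.+1) (iter_step b v.+1 d')
  else fun n => (n == 0)%N%:R.

(** Both sides obey the same recursion over strips, [fill_sum_step] and [det_JT_bstep], and agree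
    when no entry is left. *)
Theorem fill_sum_JT (N M : nat) (b : bool) (d v : nat) (c : 'I_N -> nat) :
  (v + d = M)%N -> shape c -> fill_sum M b v c = \det (JT (iter_step b v d) c).
Proof.
elim: d v c => [|d IH] v c vd sc.
  by rewrite -vd addn0 fill_sum_top // /iter_step det_JT_pred1.
rewrite fill_sum_step //; last by lia.
rewrite /= det_JT_bstep //; last exact: hX.
apply: eq_bigr => c' /andP[_ sc']; rewrite IH //; lia.
Qed.

End FillingSums.

(** * Partitions satisfying the hypotheses, and the indices [mval] *)

Definition fits (N : nat) (mu : seq nat) : Prop :=
  sorted geq mu /\ (forall j, (1 <= j <= N)%N -> (part mu j < N.+1 - j)%N).

Definition part_len (N : nat) (mu : seq nat) : 'I_N -> nat :=
  fun j => part mu j.+1.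

Lemma part_nonincreasing (mu : seq nat) (i j : nat) :
  sorted geq mu -> (i <= j)%N -> (part mu j.+1 <= part mu i.+1)%N.
Proof.
move=> smu ij; rewrite /part /=; have [hj|hj] := ltnP j (size mu); last first.
  by rewrite nth_default.
have tr : transitive geq by move=> x y z /=; lia.
have := sorted_leq_nth tr (fun x => leqnn x) 0%N smu.
by apply; rewrite ?inE //; lia.
Qed.

Lemma part_staircase_total (n j : nat) : part (staircase n) j.+1 = (n - j)%N.
Proof.
have [jn|nj] := ltnP j n; first by rewrite part_staircase ?subSS //; lia.
by rewrite /part /= nth_default ?size_rev ?size_iota //; lia.
Qed.

Lemma sorted_staircase (n : nat) : sorted geq (staircase n).
Proof.
rewrite /staircase rev_sorted.
by apply: (sub_sorted (e := ltn)) (iota_ltn_sorted _ _) => x y /ltnW.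
Qed.

Lemma fits_staircase (n : nat) : fits n.+1 (staircase n.-1).
Proof.
split; first exact: sorted_staircase.
by case=> // j hj; rewrite part_staircase_total; lia.
Qed.

Section Fits.
Variables (N : nat) (mu : seq nat) (hmu : fits N mu).

Lemma fits_lt (j : 'I_N) : (part mu j.+1 + j < N)%N.
Proof. by case: hmu => _ h; have := h j.+1; have := ltn_ord j; lia. Qed.

Lemma shape_part_len : shape (part_len (N := N) mu).
Proof.
apply/shapeP; split=> [j|l j lj]; first exact: ltnW (fits_lt j).
by apply: part_nonincreasing => //; case: hmu.
Qed.

(** The largest index in row [j] of [JT] is even exactly for [j] in [J0], and [mval] is its half
    rounded down; this decides which half of [f] the row reads. *)
Lemma mval_J0 (j : 'I_N) : j \in J0 N mu ->
  (N + j = part mu j.+1 + (mval mu j).*2)%N.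
Proof.
move=> jJ; rewrite /mval jJ; move: jJ; rewrite inE.
by have := fits_lt j; lia.
Qed.

Lemma mval_J1 (j : 'I_N) : j \notin J0 N mu ->
  (N + j = part mu j.+1 + (mval mu j).*2.+1)%N.
Proof.
move=> jJ; rewrite /mval (negbTE jJ); move: jJ; rewrite inE negbK => /eqP.
by have := fits_lt j; lia.
Qed.

Lemma mval_lt (j : 'I_N) : (mval mu j < N)%N.
Proof.
have := ltn_ord j; have := fits_lt j.
by have [/mval_J0|/mval_J1] := boolP (j \in J0 N mu); lia.
Qed.

Lemma mval_increasing (i j : 'I_N) : i \in J0 N mu -> j \in J0 N mu ->
  (i < j)%N -> (mval mu i < mval mu j)%N.
Proof.
move=> /mval_J0 iE /mval_J0 jE ij; case: hmu => smu _.
by have := part_nonincreasing smu (ltnW ij); lia.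
Qed.

End Fits.

Lemma map_val_enum (N : nat) (A : {set 'I_N}) (a : pred nat) :
  (forall i : 'I_N, (i \in A) = a i) ->
  [seq val i | i <- enum A] = seq.filter a (iota 0 N).
Proof.
move=> Aa; rewrite -val_enum_ord filter_map; congr map.
by rewrite enumT /enum_mem; apply: eq_filter => i; rewrite /= -Aa.
Qed.

(** * Toeplitz factorization and reduction to the kept minor *)

Section Toeplitz.
Variable R : comNzRingType.

(** Division of power series: as [E 0 = 1], the equation of order [L] can be solved for [y L]. *)
Lemma exists_series_quotient (E O : nat -> R) (L : nat) : E 0%N = 1 ->
  exists y : nat -> R, forall n, (n < L)%N ->
    O n = \sum_(k < n.+1) E k * y (n - k)%N.
Proof.
move=> E0; elim: L => [|L [y IH]]; first by exists (fun=> 0).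
pose z n := if (n < L)%N then y n
            else O n - \sum_(k < n) E k.+1 * y (n - k.+1)%N.
exists z => n; rewrite ltnS leq_eqVlt => /predU1P[->|nL].
  rewrite big_ord_recl E0 mul1r subn0 {1}/z ltnn.
  rewrite [X in _ + X](eq_bigr (fun k : 'I_L => E k.+1 * y (L - k.+1)%N)).
    by rewrite subrK.
  by move=> k _; rewrite /z /= /bump /= add1n ifT //; have := ltn_ord k; lia.
rewrite IH //; apply: eq_bigr => k _; rewrite /z ifT //; lia.
Qed.

Definition toeplitz_cols (N : nat) (mu : seq nat) (y : nat -> R) : 'M[R]_N :=
  \matrix_(i, j) shifted y (mval mu j) i.

(* [Fmx] with [y n] in place of [(-1) ^ n * Bval n]. *)
Definition Fmx_of (N : nat) (mu : seq nat) (y : nat -> R) : 'M[R]_#|J1 N mu| :=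
  mxsub (fun p : 'I_#|J1 N mu| => nth (enum_val p) (enum (kept_rows N mu)) p)
        (fun q : 'I_#|J1 N mu| => enum_val q) (toeplitz_cols N mu y).

Definition unit_toeplitz (N : nat) (mu : seq nat) (y : nat -> R) : 'M[R]_N :=
  \matrix_(i, j) (if j \in J0 N mu then (i == mval mu j :> nat)%:R
                  else shifted y (mval mu j) i).

(* Column [j] of the transpose of [JT] holds [f] at even or at odd places,
   according to whether [j] is in [J0]. Writing the odd part of [f] as the
   product of its even part and [y], a unitriangular Toeplitz factor splits off,
   which turns the columns of [J0] into unit vectors. *)
Lemma det_JT_unit_toeplitz (f y : nat -> R) (N : nat) (mu : seq nat) :
  f 0%N = 1 -> fits N mu ->
  (forall n, (n < N)%N ->
     f n.*2.+1 = \sum_(k < n.+1) f k.*2 * y (n - k)%N) ->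
  \det (JT f (part_len (N := N) mu)) = \det (unit_toeplitz N mu y).
Proof.
move=> f0 hmu hy.
pose U : 'M[R]_N := \matrix_(i, k) shifted (fun n => f n.*2) k i.
have dU : \det U = 1.
  rewrite -det_tr det_trig; last first.
    by apply/is_trig_mxP => i j ij; rewrite !mxE /shifted leqNgt ij.
  by rewrite big1 // => i _; rewrite !mxE /shifted leqnn subnn.
rewrite -det_tr -[RHS]mul1r -dU -det_mulmx; congr (\det _).
apply/matrixP => i j; rewrite !mxE.
have mN := mval_lt hmu j; set m := mval mu j in mN *.
have [jJ|jJ] := boolP (j \in J0 N mu).
  rewrite (bigD1 (Ordinal mN)) //= !mxE jJ eqxx mulr1 big1 ?addr0; last first.
    by move=> k km; rewrite !mxE jJ -/m -val_eqE /= in km *; rewrite (negbTE km) mulr0.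
  have := mval_J0 hmu jJ; rewrite -/m /shifted /part_len /= => E.
  case: (leqP i m) => im; last by rewrite ifN //; lia.
  by rewrite ifT; [congr f|]; lia.
have := mval_J1 hmu jJ; rewrite -/m {1}/shifted /part_len => E.
under eq_bigr => k _ do rewrite !mxE (negbTE jJ) -/m.
case: (leqP i m) => im; last first.
  rewrite ifN; last by lia.
  rewrite big1 // => k _; rewrite /shifted; case: leqP => ik; last by rewrite mul0r.
  by rewrite ifN ?mulr0 //; lia.
rewrite ifT; last by lia.
have -> : (N + j - (part mu j.+1 + i.*2) = (m - i).*2.+1)%N by lia.
rewrite hy; last by lia.
(* Only [i <= k <= m] contributes, which leaves the convolution defining [y], shifted by [i]. *)
rewrite (bigID (fun k : 'I_N => (i <= k < m.+1)%N)) /= [X in _ + X]big1; last first.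
  move=> k hk; rewrite /shifted; case: leqP => ik; last by rewrite mul0r.
  by rewrite ifN ?mulr0 //; lia.
rewrite addr0 (@big_ord_range _ _ _ N i m.+1
  (fun k => shifted (fun n => f n.*2) k i * shifted y m k)) //.
have -> (G : nat -> R) : \sum_(i <= e < m.+1) G e = \sum_(k < (m - i).+1) G (k + i)%N.
  by rewrite -{1}[i : nat]add0n big_addn subSn // big_mkord.
apply: eq_bigr => k _; have := ltn_ord k => hk.
rewrite /shifted leq_addl addnK ifT; last by lia.
by congr (_ * y _); lia.
Qed.

Lemma det_unit_toeplitz (y : nat -> R) (N : nat) (mu : seq nat) : fits N mu ->
  \det (unit_toeplitz N mu y)
  = (-1) ^+ lval N mu * \det (Fmx_of N mu y).
Proof.
move=> hmu.
pose F (i j : nat) : R :=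
  if insub j is Some jo then
    if jo \in J0 N mu then (i == mval mu jo)%:R else shifted y (mval mu jo) i
  else 0.
have FE i (j : 'I_N) : F i j = if j \in J0 N mu then (i == mval mu j)%:R
                               else shifted y (mval mu j) i.
  by rewrite /F valK.
have -> : unit_toeplitz N mu y = \matrix_(i < N, j < N) F i j.
  by apply/matrixP => i j; rewrite !mxE FE.
(* Reversed because [det_unit_cols] wants rows and columns decreasing; both increase along [J0] by
   [mval_increasing]. *)
pose s := rev [seq (mval mu j, val j) | j <- enum (J0 N mu)].
have s1 : unzip1 s = rev [seq mval mu j | j <- enum (J0 N mu)].
  by rewrite /s /unzip1 map_rev -map_comp.
have s2 : unzip2 s = rev [seq val j | j <- enum (J0 N mu)].
  by rewrite /s /unzip2 map_rev -map_comp.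
have pE : pairwise (fun i j : 'I_N => (i < j)%N) (enum (J0 N mu)).
  rewrite -(pairwise_map val ltn) (map_val_enum (a := fun i =>
    if insub i is Some j then j \in J0 N mu else false)); last by move=> i; rewrite valK.
  rewrite -sorted_pairwise; last exact: ltn_trans.
  by rewrite sorted_filter ?iota_ltn_sorted //; apply: ltn_trans.
have dec (g : 'I_N -> nat) :
    (forall i j, i \in J0 N mu -> j \in J0 N mu -> (i < j)%N -> (g i < g j)%N) ->
    pairwise (fun x y => y < x)%N (rev [seq g j | j <- enum (J0 N mu)]).
  move=> gI; rewrite -sorted_pairwise; last by move=> x1 x2 x3 /=; lia.
  rewrite rev_sorted sorted_pairwise; last by move=> x1 x2 x3 /=; lia.
  rewrite pairwise_map; apply: (sub_in_pairwise (P := mem (J0 N mu))) pE.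
    by move=> i j iJ jJ /=; apply: gI.
  by apply/allP => i; rewrite mem_enum.
rewrite (@det_unit_cols _ F N s); first last.
- move=> p i; rewrite mem_rev => /mapP[j]; rewrite mem_enum => jJ -> _ /=.
  by rewrite FE jJ.
- by rewrite s2 all_rev all_map; apply/allP => j _ /=.
- by rewrite s2; apply: dec.
- by rewrite s1 all_rev all_map; apply/allP => j _ /=; apply: mval_lt.
- by rewrite s1; apply: dec => i j; apply: mval_increasing.
congr (_ * _).
  (* With [j] counted from 0, each summand of [lval] is [m + j + 2] against [m + j] here, so the
     parities agree. *)
  rewrite /lval (perm_big _ (permEl (perm_rev _))) big_map big_enum /=.
  rewrite -signr_odd -[RHS]signr_odd; congr (_ ^+ nat_of_bool _).
  elim/big_rec2: _ => // j p q _; rewrite !oddD => ->.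
  by rewrite /=; case: (odd q); case: (odd j); case: (odd (mval _ _)).
have J1E (i : 'I_N) : (i \in J1 N mu) = (i \notin J0 N mu) by rewrite !inE negbK.
have sz : (N - size s = #|J1 N mu|)%N.
  rewrite size_rev size_map -cardE.
  have -> : J1 N mu = ~: J0 N mu by apply/setP => j; rewrite J1E finset.in_setC.
  by rewrite cardsCs finset.setCK card_ord.
have -> : left_out N (unzip1 s) = [seq val i | i <- enum (kept_rows N mu)].
  rewrite (map_val_enum (a := fun i => i \notin unzip1 s)) // => i.
  rewrite s1 mem_rev inE; apply/forall_inP/negP => [h /mapP[j]|h j jJ].
    by rewrite mem_enum => jJ E; have := h j jJ; rewrite E eqxx.
  by apply/eqP => -[E]; apply: h; apply/mapP; exists j; rewrite ?mem_enum.
have -> : left_out N (unzip2 s) = [seq val i | i <- enum (J1 N mu)].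
  rewrite (map_val_enum (a := fun i => i \notin unzip2 s)) // => i.
  by rewrite s2 mem_rev mem_map ?mem_enum ?J1E //; apply: val_inj.
rewrite sz; congr (\det _); apply/matrixP => p q; rewrite !mxE.
have [smu hN] := hmu; have cK := card_kept_rows smu hN.
rewrite (nth_map (enum_val p)); last by rewrite -cardE cK.
rewrite (nth_map (enum_val q)); last by rewrite -cardE.
rewrite -(enum_val_nth (enum_val q)) FE ifN //.
by rewrite -J1E; apply: enum_valP.
Qed.

(** Every column but the last is in [J0], with its unit just below the diagonal. So row 0 has the
    single entry [y n], in the last column, and deleting both leaves the identity. *)
Lemma det_unit_toeplitz_staircase (y : nat -> R) (n : nat) :
  \det (unit_toeplitz n.+1 (staircase n.-1) y) = (-1) ^+ n * y n.
Proof.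
have fmu := fits_staircase n; set mu := staircase n.-1 in fmu *.
have J0E (j : 'I_n.+1) : (j \in J0 n.+1 mu) = (j < n)%N.
  by rewrite inE part_staircase_total; have := ltn_ord j; lia.
have m0 (j : 'I_n.+1) : (j < n)%N -> mval mu j = j.+1.
  move=> jn; have /(mval_J0 fmu) : j \in J0 n.+1 mu by rewrite J0E.
  by rewrite part_staircase_total -/mu; lia.
have m1 : mval mu (ord_max : 'I_n.+1) = n.
  have /(mval_J1 fmu) : (ord_max : 'I_n.+1) \notin J0 n.+1 mu by rewrite J0E /= ltnn.
  by rewrite part_staircase_total -/mu /=; lia.
rewrite (expand_det_row _ ord0) big_ord_recr /= big1 ?add0r; last first.
  by move=> j _; rewrite mxE J0E /= ltn_ord m0 //= mul0r.
rewrite mxE J0E /= ltnn m1 /shifted leq0n subn0 mulrC; congr (_ * _).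
rewrite /cofactor add0n (_ : row' _ _ = 1%:M) ?det1 ?mulr1 //.
apply/matrixP => i j; rewrite !mxE J0E lift_max ltn_ord m0 lift_max // lift0 eqSS.
Qed.

(** The factorization is used twice: for [mu], and for the ribbons [delta_{n+1} / delta_{n-1}],
    which give [y n] and so eliminate [y]. *)
Theorem det_JT_toeplitz (f : nat -> R) (N : nat) (mu : seq nat) :
  f 0%N = 1 -> fits N mu ->
  \det (JT f (part_len (N := N) mu))
  = (-1) ^+ lval N mu * \det (Fmx_of N mu (fun n =>
      (-1) ^+ n * \det (JT f (part_len (N := n.+1) (staircase n.-1))))).
Proof.
move=> f0 hmu.
have [y hy] := @exists_series_quotient (fun n => f n.*2) (fun n => f n.*2.+1) N.+1 f0.
rewrite (@det_JT_unit_toeplitz f y) // => [|n nN]; last by apply: hy; lia.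
rewrite det_unit_toeplitz //; congr (_ * \det _).
apply/matrixP => p q; rewrite !mxE /shifted; case: leqP => // ij.
set m := mval _ _; set i := nth _ _ _; have mN : (m < N)%N by apply: mval_lt.
rewrite (@det_JT_unit_toeplitz f y) // => [||n nN]; last first.
- by apply: hy; lia.
- exact: fits_staircase.
by rewrite det_unit_toeplitz_staircase mulrA -expr2 sqrr_sign mul1r.
Qed.

End Toeplitz.

(** * Conjugate partitions and transposed fillings *)

Lemma count_gt_sorted (mu : seq nat) (j k : nat) : sorted geq mu ->
  (j < count (fun x => k < x)%N mu)%N = (k < nth 0 mu j)%N.
Proof.
elim: mu j => [|x mu IH] j; first by rewrite nth_nil.
move=> /= pm; have sm := path_sorted pm.
have [kx|xk] := ltnP k x; first by case: j => [|j] //=; rewrite add1n ltnS IH.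
rewrite add0n; have /eqP -> : count (fun x => k < x)%N mu == 0.
  rewrite -leqn0 leqNgt -has_count; apply/hasP => -[z zmu kz].
  have tr : transitive geq by move=> x1 x2 x3 /=; lia.
  by have /allP/(_ z zmu) := order_path_min tr pm; rewrite /=; lia.
rewrite ltn0; case: j => [|j] /=; first by lia.
apply/esym/negbTE; rewrite -leqNgt; have [h|h] := ltnP j (size mu); last first.
  by rewrite nth_default.
have tr : transitive geq by move=> x1 x2 x3 /=; lia.
by have /allP/(_ _ (mem_nth 0%N h)) := order_path_min tr pm; rewrite /=; lia.
Qed.

Lemma part_conj (N : nat) (mu : seq nat) (k : nat) : (k < N)%N ->
  part (conj_part N mu) k.+1 = count (fun x => k < x)%N mu.
Proof.
move=> kN; rewrite /part /conj_part /= (nth_map 0%N) ?size_iota //.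
by rewrite nth_iota // add1n.
Qed.

Lemma fits_conj (N : nat) (mu : seq nat) : fits N mu -> fits N (conj_part N mu).
Proof.
move=> hmu; have [smu hN] := hmu; split.
  rewrite /conj_part sorted_map.
  apply: (sub_sorted (e := ltn)) (iota_ltn_sorted _ _) => x y xy /=.
  by apply: sub_count => z /=; lia.
case=> // k kN; rewrite part_conj; last by lia.
rewrite ltnNge; apply/negP => h.
have lt_c : (N - k.+1 < count (fun x => k < x)%N mu)%N by lia.
have := hN (N - k.+1).+1; move: lt_c; rewrite count_gt_sorted // /part /=; lia.
Qed.

Section Transpose.
Variables (R : comNzRingType) (X : nat -> nat -> R) (N M : nat).
Variables (mu : seq nat) (hmu : fits N mu).

Lemma in_skew_conj (p : 'I_N * 'I_N) :
  in_skew (part_len (conj_part N mu)) (p.2, p.1) = in_skew (part_len mu) p.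
Proof.
rewrite /in_skew /part_len /= part_conj // leqNgt count_gt_sorted; last by case: hmu.
by rewrite -leqNgt addnC.
Qed.

Let tr (t : {ffun 'I_N * 'I_N -> 'I_M.+1}) : {ffun 'I_N * 'I_N -> 'I_M.+1} :=
  [ffun p => t (p.2, p.1)].

(** Reflection exchanges strict columns with strict rows, and both the staircase and the weight
    index [N + j + k] are symmetric. *)
Lemma fill_sum_conj :
  fill_sum X M false 0 (part_len (N := N) mu)
  = fill_sum X M true 0 (part_len (N := N) (conj_part N mu)).
Proof.
have trK : involutive tr by move=> t; apply/ffunP => -[i j]; rewrite !ffunE.
have E (i j : 'I_N) : in_skew (part_len mu) (i, j) = in_skew (part_len (conj_part N mu)) (j, i).
  by rewrite -(in_skew_conj (i, j)).
rewrite /fill_sum (reindex_inj (inv_inj trK)); apply: eq_big => [t|t _].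
  apply/bfillP/bfillP => -[h1 h2 h3 h4]; split.
  - by move=> [i j]; rewrite -E => /h1; rewrite ffunE.
  - by move=> [i j]; rewrite -E => /h2; rewrite ffunE.
  - move=> [i j] [i' j']; rewrite -!E => hp hq /= e l.
    by have := h4 _ _ hp hq e l; rewrite !ffunE.
  - move=> [i j] [i' j']; rewrite -!E => hp hq /= e l.
    by have := h3 _ _ hp hq e l; rewrite !ffunE.
  - by move=> [i j]; rewrite E => /h1; rewrite ffunE.
  - by move=> [i j]; rewrite E => /h2; rewrite ffunE.
  - move=> [i j] [i' j']; rewrite !E => hp hq /= e l.
    by have := h4 _ _ hp hq e l; rewrite !ffunE.
  - move=> [i j] [i' j']; rewrite !E => hp hq /= e l.
    by have := h3 _ _ hp hq e l; rewrite !ffunE.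
pose sw (p : 'I_N * 'I_N) := (p.2, p.1).
have swK : involutive sw by case.
rewrite /fill_weight (reindex_inj (inv_inj swK)); apply: eq_big => [[i j]|[i j] _].
  by rewrite E.
by rewrite ffunE /= addnAC.
Qed.

End Transpose.

(** * Bounds uniform in the truncation *)

Section Bounds.
Variables (R : realType) (a b : nat) (ha : (0 < a)%N) (hb : (2 <= b)%N).

(** Corners satisfy [j + k = N - 1], so their index [N + j + k] is odd and odd indices carry [b]. *)
Definition zweight (v n : nat) : R := v%:R ^- (if odd n then b else a).

Lemma zweight_parity v m n : odd m = odd n -> zweight v m = zweight v n.
Proof. by rewrite /zweight => ->. Qed.

Lemma zweight_ge0 v n : 0 <= zweight v n.
Proof. by rewrite invr_ge0 exprn_ge0. Qed.

Lemma zweight_le (k v n : nat) : (0 < v)%N -> (k <= if odd n then b else a)%N ->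
  zweight v n <= v%:R ^- k.
Proof.
move=> v0 kn; rewrite /zweight lef_pV2 ?posrE ?exprn_gt0 ?ltr0n //.
by apply: ler_weXn2l => //; rewrite ler1n.
Qed.

(** The bound [1 / v] survives a step since [1 / (v + 1) + 1 / (v + 1) ^ 2 <= 1 / v]. The added term
    is at most [1 / (v + 1) ^ 2]: for [n = 1] the cell is a corner and [b >= 2]; for larger [n] one
    factor comes from the induction hypothesis. *)
Lemma iter_step_bounds (d v n : nat) : (0 < v)%N ->
  [/\ 0 <= iter_step zweight true v d n,
      iter_step zweight true v d 0 = 1
    & (0 < n)%N -> iter_step zweight true v d n <= v%:R^-1].
Proof.
elim: d v n => [|d IH] v n v0.
  split=> //=.
  by case: n => // n _; rewrite invr_ge0.
have [h0 e0 le0] := IH v.+1 n isT.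
split; rewrite /= /estep.
- rewrite addr_ge0 //; case: n h0 le0 => // n _ _.
  by rewrite mulr_ge0 ?zweight_ge0 //; have [] := IH v.+1 n isT.
- by rewrite e0 addr0.
case: n h0 le0 => // n h0 le0 _; have [g0 _ le1] := IH v.+1 n isT.
have v1 : 0 < v%:R :> R by rewrite ltr0n.
have xle : zweight v.+1 n.+1 * iter_step zweight true v.+1 d n <= v.+1%:R ^- 2.
  case: n {h0 le0} g0 le1 => [|n] g0 le1.
    by have [_ -> _] := IH v.+1 0%N isT; rewrite mulr1; apply: zweight_le.
  rewrite expr2 invfM; apply: ler_pM => //; first exact: zweight_ge0.
    by apply: (zweight_le (k := 1)) => //; case: ifP => _ //; lia.
  exact: le1.
apply: (le_trans (lerD (le0 isT) xle)).
rewrite -natr1; move: (v%:R) v1 => x x0.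
have x1 : 0 < x + 1 by rewrite addr_gt0.
rewrite -[X in X <= _](_ : (x + 2) / (x + 1) ^+ 2 = _); last first.
  by field; apply: lt0r_neq0.
rewrite ler_pdivrMr ?exprn_gt0 // mulrC ler_pdivlMr //.
by rewrite expr2; nra.
Qed.

(** Sums with entries above 1 are at most 1, and the entry 1, of weight 1, adds at most 1 more. *)
Lemma iter_step_le2 (d n : nat) :
  0 <= iter_step zweight true 0 d n <= 2.
Proof.
case: d => [|d] /=; first by case: (n == 0)%N; rewrite ?ler0n ?ler_nat.
have [g0 e0 le1] := @iter_step_bounds d 1 n isT.
have gle k : 0 <= iter_step zweight true 1 d k <= 1.
  have [-> ek] := @iter_step_bounds d 1 k isT; rewrite invr1 /=.
  by case: k => [_|k]; [rewrite ek | apply].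
rewrite /estep; have /andP[n0 n1] := gle n; case: n n0 n1 {g0 le1} => [|n] n0 n1.
  by rewrite addr0 n0 (le_trans n1) ?ler1n //.
have /andP[m0 m1] := gle n.
have -> : zweight 1 n.+1 = 1 by rewrite /zweight expr1n invr1.
by rewrite mul1r addr_ge0 //= -[2]/(1 + 1) lerD.
Qed.

(** Transposing first gives a determinant in the strict sums, whose entries lie between 0 and 2 for
    every [M]; the Leibniz formula then bounds it. *)
Lemma fill_sum_bounded (N : nat) (mu : seq nat) : fits N mu ->
  exists C : R, forall M,
    fill_sum zweight M false 0 (part_len (N := N) mu) <= C.
Proof.
move=> hmu; exists (\sum_(s : 'S_N) \prod_(i < N) 2) => M.
rewrite fill_sum_conj // (@fill_sum_JT _ _ zweight_parity _ _ _ M) //; last first.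
  exact/shape_part_len/fits_conj.
apply: le_trans (ler_norm _) _; apply: le_trans (ler_norm_sum _ _ _) _.
apply: ler_sum => s _; rewrite normrM normr_sign mul1r normr_prod.
apply: ler_prod => i _; rewrite normr_ge0 /= mxE /shifted.
case: leqP => _; last by rewrite normr0.
by set k := (_ - _)%N; have /andP[h0 h2] := iter_step_le2 M k; rewrite ger0_norm.
Qed.

End Bounds.

(** * Infinite sums as limits along a finite exhaustion *)

Section EsumLimit.
Local Open Scope classical_set_scope.
Import numFieldNormedType.Exports.

Lemma cvg_fine_esum (R : realType) (T : choiceType) (S : set T) (w : T -> R)
    (r : nat -> seq T) (C : R) :
  (forall x, S x -> 0 <= w x) -> (forall M, uniq (r M)) ->
  (forall M x, x \in r M -> S x) ->
  (forall x, S x -> exists M0, forall M, (M0 <= M)%N -> x \in r M) ->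
  (forall M, \sum_(x <- r M) w x <= C) ->
  (fun M => \sum_(x <- r M) w x) @ \oo --> fine (\esum_(x in S) (w x)%:E)%E.
Proof.
move=> w0 ur rS Sr uC; set e := (\esum_(x in S) (w x)%:E)%E.
pose u M := \sum_(x <- r M) w x.
(* Every finite partial sum is eventually dominated by [u], so the supremum of these sums is the
   limit of [u]. *)
have finsub (A : set T) : fsets S A -> exists M0, forall M, (M0 <= M)%N ->
    (\sum_(x \in A) (w x)%:E <= (u M)%:E)%E.
  move=> [fA AS]; rewrite fsbig_finite //; set s := (X in \sum_(x <- X) _).
  have us : uniq s by apply: finmap.fset_uniq.
  have sS x : x \in s -> S x.
    by rewrite /s in_fset_set // inE => /AS.
  clearbody s; have [M0 hM0] : exists M0, forall M, (M0 <= M)%N -> {subset s <= r M}.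
    elim: s sS {us} => [|x s IH] sS; first by exists 0%N.
    have [|M1 h1] := IH; first by move=> y ys; apply: sS; rewrite inE ys orbT.
    have [M2 h2] := Sr x (sS x (mem_head _ _)).
    exists (maxn M1 M2) => M; rewrite geq_max => /andP[m1 m2] y.
    by rewrite inE => /predU1P[->|]; [apply: h2 | apply: h1].
  exists M0 => M /hM0 sub; rewrite sumEFin lee_fin /u.
  rewrite [leRHS](bigID (mem s)) /= -[leRHS]/(_ + _).
  rewrite -[X in _ <= X + _]big_filter [X in _ <= X + _](perm_big s) /=; last first.
    apply: uniq_perm => //; first exact: filter_uniq.
    by move=> x; rewrite mem_filter /=; case: (boolP (x \in s)) => // /sub ->.
  by rewrite lerDl big_seq_cond sumr_ge0 // => x /andP[/rS /w0].
have ule M : ((u M)%:E <= e)%E.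
  apply: esum_ge; exists [set` r M]; last by rewrite -fsbig_seq // sumEFin.
  by split=> [|x /=]; [exact: finite_seq | exact: rS].
have e_le : (e <= C%:E)%E.
  apply: ge_ereal_sup => _ [A /finsub[M0 /(_ M0 (leqnn _)) h] <-].
  by apply: le_trans h _; rewrite lee_fin; apply: uC.
have e_fin : e \is a fin_num.
  rewrite fin_numElt (lt_le_trans _ (ule 0%N)) ?ltNyr //=.
  by rewrite (le_lt_trans e_le) ?ltry.
apply/cvgrPdist_le => eps eps0.
have [_ [A /finsub[M0 hM0] <-] lt_e] := ub_ereal_sup_adherent eps0 e_fin.
exists M0 => // M /= /hM0 /(lt_le_trans lt_e).
rewrite -[ereal_sup _]/e -(fineK e_fin) -EFinB lte_fin => h1.
have := ule M; rewrite -(fineK e_fin) lee_fin => h2.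
by rewrite ger0_norm ?subr_ge0 // -/(u M); lra.
Qed.

End EsumLimit.

(** * Padded grid fillings against the semistandard fillings of the definition *)

Section GridFillings.
Variables (N : nat) (mu : seq nat) (hmu : fits N mu).
Notation D := (Defs.skew (staircase N) mu).
Notation c := (part_len (N := N) mu).

Lemma mem_skew_staircase (x : cell) :
  (x \in D) = [&& (0 < x.1)%N, (part mu x.1 < x.2)%N & (x.1 + x.2 <= N.+1)%N].
Proof.
case: x => i j; rewrite mem_skew size_rev size_iota /=.
have [hi|hi] := boolP (1 <= i <= N)%N; last first.
  by apply/esym/negbTE/negP => /and3P[h1 h2 h3]; move: hi; lia.
by rewrite part_staircase //; lia.
Qed.

Lemma cell_row_lt (x : seq_sub D) : ((val x).1.-1 < N)%N.
Proof. by have := valP x; rewrite mem_skew_staircase; case: (val x) => i j /=; lia. Qed.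

Lemma cell_col_lt (x : seq_sub D) : ((val x).2.-1 < N)%N.
Proof. by have := valP x; rewrite mem_skew_staircase; case: (val x) => i j /=; lia. Qed.

Definition cell_pos (x : seq_sub D) : 'I_N * 'I_N :=
  (Ordinal (cell_row_lt x), Ordinal (cell_col_lt x)).

Lemma cell_posE (x : seq_sub D) :
  val x = ((cell_pos x).1.+1, (cell_pos x).2.+1).
Proof.
have := valP x; rewrite mem_skew_staircase /=; case: (val x) => i j /=.
by move=> ?; congr (_, _); lia.
Qed.

Lemma mem_skew_pos (p : 'I_N * 'I_N) :
  ((p.1.+1, p.2.+1) \in D) = in_skew c p.
Proof. by rewrite mem_skew_staircase /in_skew /part_len /=; lia. Qed.

Lemma in_skew_cell_pos (x : seq_sub D) : in_skew c (cell_pos x).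
Proof. by rewrite -mem_skew_pos -cell_posE; apply: valP. Qed.

Lemma cell_pos_inj : injective cell_pos.
Proof. by move=> x y E; apply: val_inj; rewrite cell_posE E -cell_posE. Qed.

Lemma cell_pos_onto (p : 'I_N * 'I_N) :
  in_skew c p -> exists x, cell_pos x = p.
Proof.
rewrite -mem_skew_pos => pD; exists (SeqSub pD).
by case: p pD => i j pD; congr (_, _); apply: val_inj.
Qed.

Lemma prod_cell_pos (R : comNzRingType) (F : 'I_N * 'I_N -> R) :
  \prod_(x : seq_sub D) F (cell_pos x) = \prod_(p | in_skew c p) F p.
Proof.
rewrite -(big_map cell_pos xpredT F) -[RHS]big_filter; apply: perm_big.
apply: uniq_perm.
- by rewrite (map_inj_uniq cell_pos_inj) index_enum_uniq.
- by rewrite filter_uniq ?index_enum_uniq.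
move=> p; rewrite mem_filter mem_index_enum andbT.
apply/mapP/idP => [[x _ ->]|/cell_pos_onto[x <-]].
  exact: in_skew_cell_pos.
by exists x => //; apply: mem_index_enum.
Qed.

Lemma checkerboard_staircase (a b : nat) (x : seq_sub D) :
  checkerboard a b D x
  = if odd (N + (cell_pos x).1 + (cell_pos x).2) then b else a.
Proof.
have [|e [hk hc]] := @is_checkerboard_staircase a b N mu; first by case: hmu.
have px : odd (N + (cell_pos x).1 + (cell_pos x).2) = (parity (val x) == odd N.+1).
  by rewrite cell_posE /parity /=; lia.
rewrite px; have [E|nE] := eqVneq e (odd N.+1); first by rewrite hk E.
(* With the other parity class, the corner [(1, N)] would receive both [a] and [b]; then [a = b] and
   the filling is constant. *)
have N0 : (0 < N)%N by apply: leq_ltn_trans (cell_row_lt x).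
have h1 := fits_lt hmu (Ordinal N0).
have yD : (1%N, N) \in D by rewrite mem_skew_staircase /=; move: h1; rewrite /=; lia.
have yc : corner D (1%N, N).
  by apply/and3P; split=> //; rewrite mem_skew_staircase /=; lia.
have ab : a = b.
  rewrite -(hc (SeqSub yD) yc) hk (_ : parity (val (SeqSub yD)) = odd N.+1) //.
  by rewrite eq_sym (negbTE nE).
by rewrite hk ab !if_same.
Qed.

Variable M : nat.

Definition of_grid (t : {ffun 'I_N * 'I_N -> 'I_M.+1}) : filling D :=
  [ffun x => nat_of_ord (t (cell_pos x))].

Definition to_grid (m : filling D) : {ffun 'I_N * 'I_N -> 'I_M.+1} :=
  [ffun p : 'I_N * 'I_N =>
    if insub (p.1.+1, p.2.+1) is Some x then inord (m x) else ord0].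

Lemma of_grid_inj : {in bfill false 0 c &, injective of_grid}.
Proof.
move=> t t' /bfillP[h1 _ _ _] /bfillP[h1' _ _ _] E.
apply/ffunP => p; apply: val_inj => /=.
have [/cell_pos_onto[x <-]|np] := boolP (in_skew c p); last by rewrite h1 // h1'.
by have /ffunP/(_ x) := E; rewrite !ffunE.
Qed.

Lemma semistandard_of_grid (t : {ffun 'I_N * 'I_N -> 'I_M.+1}) :
  bfill false 0 c t -> semistandard (of_grid t).
Proof.
move=> /bfillP[h1 h2 h3 h4]; split=> [x|x y e l|x y e l]; rewrite !ffunE.
- exact: h2 (in_skew_cell_pos x).
- have := h4 _ _ (in_skew_cell_pos x) (in_skew_cell_pos y).
  rewrite /= addn1; apply; first by apply: val_inj; rewrite /= e.
  by move: l; rewrite (cell_posE x) (cell_posE y) /=; lia.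
- move: l; rewrite leq_eqVlt => /predU1P[E|l].
    have -> : x = y by apply: val_inj; rewrite [LHS]surjective_pairing e E -surjective_pairing.
    exact: leqnn.
  have := h3 _ _ (in_skew_cell_pos x) (in_skew_cell_pos y).
  rewrite /= addn0; apply; first by apply: val_inj; rewrite /= e.
  by move: l; rewrite (cell_posE x) (cell_posE y) /=; lia.
Qed.

Section ToGrid.
Variables (m : filling D) (sm : semistandard m) (mM : forall x, (m x <= M)%N).

Lemma to_grid_pos (x : seq_sub D) : to_grid m (cell_pos x) = m x :> nat.
Proof. by rewrite ffunE -cell_posE valK inordK // ltnS. Qed.

Lemma to_gridK : of_grid (to_grid m) = m.
Proof. by apply/ffunP => x; rewrite ffunE to_grid_pos. Qed.

Lemma bfill_to_grid : bfill false 0 c (to_grid m).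
Proof.
have [m0 mc mr] := sm; apply/bfillP; split.
- move=> p np; rewrite ffunE insubF //.
  by rewrite mem_skew_pos (negbTE np).
- by move=> p /cell_pos_onto[x <-]; rewrite to_grid_pos.
- move=> p q /cell_pos_onto[x <-] /cell_pos_onto[y <-] e l.
  rewrite !to_grid_pos addn0; apply: mr; rewrite cell_posE (cell_posE y) /=.
    by have /(congr1 val) /= := e => ->.
  by move: l => /=; lia.
- move=> p q /cell_pos_onto[x <-] /cell_pos_onto[y <-] e l.
  rewrite !to_grid_pos addn1; apply: mc; rewrite cell_posE (cell_posE y) /=.
    by have /(congr1 val) /= := e => ->.
  by move: l => /=; lia.
Qed.

End ToGrid.
End GridFillings.

(** * Convergence of the truncated sums and of the determinants *)

Section ZetaLimit.
Local Open Scope classical_set_scope.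
Import numFieldNormedType.Exports.
Variables (R : realType) (a b : nat) (ha : (0 < a)%N) (hb : (2 <= b)%N).

Lemma cvg_zeta_ab (N : nat) (mu : seq nat) : fits N mu ->
  (fun M => fill_sum (zweight R a b) M false 0 (part_len (N := N) mu)) @ \oo
    --> zeta_ab R a b (staircase N) mu.
Proof.
move=> hmu; have [C hC] := fill_sum_bounded R ha hb hmu.
pose w (m : filling (Defs.skew (staircase N) mu)) : R :=
  \prod_(x : seq_sub (Defs.skew (staircase N) mu))
     (m x)%:R ^- checkerboard a b (Defs.skew (staircase N) mu) x.
pose r M := [seq of_grid mu t | t <- enum [pred t :
  {ffun 'I_N * 'I_N -> 'I_M.+1} | bfill false 0 (part_len mu) t]].
have uE M : fill_sum (zweight R a b) M false 0 (part_len (N := N) mu)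
            = \sum_(m <- r M) w m.
  rewrite big_map big_enum /=; apply: eq_bigr => t _.
  rewrite /w /fill_weight -prod_cell_pos; apply: eq_bigr => x _.
  by rewrite (checkerboard_staircase hmu) ffunE.
under eq_fun do rewrite uE.
apply: (cvg_fine_esum (C := C)).
- by move=> m _; rewrite /w prodr_ge0 // => x _; rewrite invr_ge0 exprn_ge0.
- move=> M; rewrite map_inj_in_uniq ?enum_uniq // => t t'; rewrite !mem_enum.
  exact: of_grid_inj.
- by move=> M m /mapP[t]; rewrite mem_enum => bt ->; apply: semistandard_of_grid.
(* The sum of all entries of [m] bounds each of them. *)
- move=> m sm; exists (\sum_x m x)%N => M hM.
  have mM x : (m x <= M)%N.
    by apply: leq_trans hM; rewrite (bigD1 x) //= leq_addr.
  apply/mapP; exists (to_grid M m); last by rewrite to_gridK.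
  by rewrite mem_enum; apply: bfill_to_grid.
- by move=> M; rewrite -uE.
Qed.

End ZetaLimit.

Section Limits.
Local Open Scope classical_set_scope.
Import numFieldNormedType.Exports.
Variable R : realType.

Lemma cvg_det (n : nat) (A : nat -> 'M[R]_n) (B : 'M[R]_n) :
  (forall i j, (fun M => A M i j) @ \oo --> B i j) ->
  (fun M => \det (A M)) @ \oo --> \det B.
Proof.
move=> AB; apply: cvg_big => [|s _]; first exact: add_continuous.
apply: cvgM; first exact: cvg_cst.
by apply: cvg_big => [|i _]; [exact: mul_continuous | exact: AB].
Qed.

Variables (a b : nat).

Lemma cvg_det_Fmx (N : nat) (mu : seq nat) (z : nat -> nat -> R) :
  (forall n, (fun M => z M n) @ \oo
     --> zeta_ab R a b (staircase n.+1) (staircase n.-1)) ->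
  (fun M => \det (Fmx_of N mu (fun n => (-1) ^+ n * z M n))) @ \oo
    --> \det (Fmx R a b N mu).
Proof.
move=> hz; apply: cvg_det => p q; under eq_fun do rewrite !mxE.
rewrite !mxE; set i := nth _ _ _; set j := enum_val q; rewrite /shifted.
case: (leqP i (mval mu j)) => ij.
  have -> : (mval mu j)%:Z - i.+1%:Z + 1 = (mval mu j - i)%N%:Z by lia.
  by rewrite /=; apply: cvgM; [exact: cvg_cst | exact: hz].
(* At a negative index [Bval] is 0, matching the cutoff in [shifted]. *)
have -> : (mval mu j)%:Z - i.+1%:Z + 1 = Negz (i - (mval mu j).+1)%N by lia.
by rewrite /= mulr0; apply: cvg_cst.
Qed.

End Limits.

Lemma iter_step0 (R : comNzRingType) (X : nat -> nat -> R) b d v :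
  iter_step X b v d 0%N = 1.
Proof. by elim: d v => //= d IH v; case: b IH => IH /=; rewrite /estep ?IH ?addr0. Qed.

(** Self-conjugacy of the staircase makes the same ribbon sums serve for [conj_part N mu]. *)
Lemma part_len_conj_staircase (n : nat) :
  part_len (N := n.+1) (conj_part n.+1 (staircase n.-1))
  = part_len (N := n.+1) (staircase n.-1).
Proof.
apply/funext => k; rewrite /part_len part_conj // part_staircase_total.
have E j : (j < count (fun x => k < x)%N (staircase n.-1))%N = (j < n.-1 - k)%N.
  rewrite count_gt_sorted ?sorted_staircase //.
  by have := part_staircase_total n.-1 j; rewrite /part /= => ->; lia.
apply/eqP; rewrite eqn_leq; apply/andP; split; rewrite leqNgt; apply/negP => h.
  by have := E (n.-1 - k)%N; rewrite ltnn h.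
by have := E (count (fun x => k < x)%N (staircase n.-1)); rewrite ltnn h.
Qed.

(** * Both identities at a finite truncation *)

Section FiniteLevel.
Variables (R : comNzRingType) (X : nat -> nat -> R) (M : nat).
Hypothesis hX : forall v m n, odd m = odd n -> X v m = X v n.

Let ribbon_sum (n : nat) : R :=
  fill_sum X M false 0 (part_len (N := n.+1) (staircase n.-1)).

Lemma fill_sum_toeplitz (N : nat) (mu : seq nat) : fits N mu ->
  fill_sum X M false 0 (part_len (N := N) mu)
  = (-1) ^+ lval N mu
    * \det (Fmx_of N mu (fun n => (-1) ^+ n * ribbon_sum n)).
Proof.
move=> hmu; rewrite (@fill_sum_JT _ _ hX _ _ _ M) ?shape_part_len //.
rewrite det_JT_toeplitz ?iter_step0 //; congr (_ * \det (Fmx_of _ _ _)).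
apply/funext => n; rewrite /ribbon_sum (@fill_sum_JT _ _ hX _ _ _ M) //.
exact/shape_part_len/fits_staircase.
Qed.

(** Here [f] is the strict sum instead of the weak one; transposing the ribbons shows that its
    quotient of odd by even part is given by the same ribbon sums. *)
Lemma fill_sum_toeplitz_conj (N : nat) (mu : seq nat) : fits N mu ->
  fill_sum X M false 0 (part_len (N := N) mu)
  = (-1) ^+ lval N (conj_part N mu)
    * \det (Fmx_of N (conj_part N mu) (fun n => (-1) ^+ n * ribbon_sum n)).
Proof.
move=> hmu; have hmu' := fits_conj hmu; rewrite fill_sum_conj //.
rewrite (@fill_sum_JT _ _ hX _ _ _ M) ?shape_part_len //.
rewrite det_JT_toeplitz ?iter_step0 //; congr (_ * \det (Fmx_of _ _ _)).
apply/funext => n; rewrite /ribbon_sum fill_sum_conj; last exact: fits_staircase.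
rewrite part_len_conj_staircase (@fill_sum_JT _ _ hX _ _ _ M) //.
exact/shape_part_len/fits_staircase.
Qed.

End FiniteLevel.

(** * Letting the truncation tend to infinity *)

Section ZetaToeplitz.
Local Open Scope classical_set_scope.
Import numFieldNormedType.Exports.
Variables (R : realType) (a b : nat) (ha : (0 < a)%N) (hb : (2 <= b)%N).

Lemma zeta_ab_toeplitz (N : nat) (mu nu : seq nat) : fits N mu ->
  (forall M, fill_sum (zweight R a b) M false 0 (part_len (N := N) mu)
    = (-1) ^+ lval N nu * \det (Fmx_of N nu (fun n => (-1) ^+ n
        * fill_sum (zweight R a b) M false 0
            (part_len (N := n.+1) (staircase n.-1))))) ->
  zeta_ab R a b (staircase N) mu = (-1) ^+ lval N nu * \det (Fmx R a b N nu).
Proof.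
move=> hmu hfin; have cz := @cvg_zeta_ab R a b ha hb N mu hmu.
rewrite -(cvg_lim (@Rhausdorff R) cz); apply: cvg_lim; first exact: Rhausdorff.
rewrite (eq_cvg _ _ hfin); apply: cvgM; first exact: cvg_cst.
by apply: cvg_det_Fmx => n; apply: cvg_zeta_ab => //; apply: fits_staircase.
Qed.

End ZetaToeplitz.

Theorem theorem4p1 (R : realType) (a b : nat) (ha : (0 < a)%N) (hb : (2 <= b)%N)
  (N : nat) (mu : N.-tuple nat) (hmu : sorted geq mu)
  (hmuN : forall j : nat, (1 <= j <= N)%N -> (part mu j < N + 1 - j)%N) :
  zeta_ab R a b (staircase N) mu
    = (-1) ^+ lval N mu * \det (Fmx R a b N mu)
  /\
  zeta_ab R a b (staircase N) mu
    = (-1) ^+ lval N (conj_part N mu) * \det (Fmx R a b N (conj_part N mu)).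
Proof.
have fmu : fits N mu by split=> // j /hmuN; rewrite addn1.
have hX := @zweight_parity R a b.
split; apply: zeta_ab_toeplitz => // M.
  exact: fill_sum_toeplitz.
exact: fill_sum_toeplitz_conj.
Qed.
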